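(* Let $B=A^{coH}\subseteq A$ be a quantum principal bundle with a complete differential calculus $\Omega^\bullet(A)$. The graded algebra $\mathrm{hor}^\bullet(A)$ of horizontal forms is $\Delta_A^\wedge$-invariant, namely $\Delta_A^\wedge(\mathrm{hor}^\bullet(A))\subseteq\mathrm{hor}^\bullet(A)\otimes H$. In other words, $\mathrm{hor}^\bullet(A)$ is a right $H$-comodule algebra.
   Context: Work over a field $\mathbb{k}$; $H$ is a Hopf algebra. A differential calculus on an algebra $A$ is a differential $\mathbb{N}_0$-graded algebra $(\Omega^\bullet,\wedge,\mathrm{d})$ with $\Omega^0=A$ and $\Omega^k=\mathrm{span}\{a^0\mathrm{d}a^1\wedge\cdots\wedge\mathrm{d}a^k\}$. Tensor products of differential graded algebras carry the product $(\omega\otimes\eta)(\omega'\otimes\eta')=(-1)^{|\eta||\omega'|}(\omega\wedge\omega')\otimes(\eta\wedge\eta')$ and the differential $\mathrm{d}\otimes\mathrm{id}+(-1)^{|\cdot|}\mathrm{id}\otimes\mathrm{d}$. Standing assumptions: $(\Gamma,\mathrm{d})$ is a bicovariant first order calculus on $H$ and $\Omega^\bullet(H)=\Gamma^\wedge$ its maximal prolongation (tensor algebra of $\Gamma$ over $H$ modulo the ideal generated by $\sum_i\mathrm{d}a^i\otimes_H\mathrm{d}b^i$ whenever $\sum_ia^i\mathrm{d}b^i=0$), such that the coproduct extends to a morphism of differential graded algebras $\Delta^\bullet:\Omega^\bullet(H)\to\Omega^\bullet(H)\otimes\Omega^\bullet(H)$. A quantum principal bundle is a faithfully flat Hopf-Galois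 extension $B=A^{coH}\subseteq A$ of a right $H$-comodule algebra $A$. A differential calculus $\Omega^\bullet(A)$ is complete if $\Delta_A:A\to A\otimes H$ extends to a morphism of differential graded algebras $\Delta_A^\wedge:\Omega^\bullet(A)\to\Omega^\bullet(A)\otimes\Omega^\bullet(H)$. Horizontal forms: $\mathrm{hor}^\bullet(A)=(\Delta_A^\wedge)^{-1}(\Omega^\bullet(A)\otimes H)$; the coaction in question is the restriction of $\Delta_A^\wedge$. *)

(* Defs.v *)
From HB Require Import structures.
From mathcomp Require Import all_boot ssralg ring_quotient generic_quotient sesquilinear.
From mathcomp Require Import boolp classical_sets.
From mathcomp Require Import freeg.

Set Implicit Arguments.
Unset Strict Implicit.
Unset Printing Implicit Defensive.

Import GRing.Theory.
Local Open Scope ring_scope.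
Local Open Scope quotient_scope.
Local Open Scope classical_set_scope.

Section Span.
Variables (k : fieldType) (V : lmodType k).
Implicit Types (S : set V) (v : V).

Definition span S : {pred V} := fun v =>
  `[< exists n (c : 'I_n -> k) (s : 'I_n -> V),
        (forall i, S (s i)) /\ v = \sum_i c i *: s i >].

Lemma span_gen S v : S v -> v \in span S.
Proof.
move=> Sv; apply/asboolP; exists 1%N, (fun=> 1), (fun=> v); split=> //.
by rewrite big_ord_recl big_ord0 scale1r addr0.
Qed.

Lemma spanP_subproof S : GRing.subsemimod_closed (span S).
Proof.
split; first split.
- by apply/asboolP; exists 0%N, (fun=> 0), (fun=> 0); split; [case | rewrite big_ord0].
- move=> u v /asboolP[m [c [s [Ss ->]]]] /asboolP[n [d [t [St ->]]]].
  apply/asboolP; exists (m + n)%N,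
    (fun i => match split i with inl j => c j | inr j => d j end),
    (fun i => match split i with inl j => s j | inr j => t j end).
  split; first by move=> i; case: (split i).
  rewrite big_split_ord /=; congr (_ + _); apply: eq_bigr => i _.
    by rewrite (unsplitK (inl i)).
  by rewrite (unsplitK (inr i)).
- move=> a v /asboolP[n [c [s [Ss ->]]]]; apply/asboolP.
  exists n, (fun i => a * c i), s; split=> //.
  by rewrite scaler_sumr; apply: eq_bigr => i _; rewrite scalerA.
Qed.

HB.instance Definition _ S :=
  GRing.isSubmodClosed.Build k V (span S) (spanP_subproof S).

Lemma span_ind S (P : V -> Prop) :
    P 0 -> (forall a u v, S u -> P v -> P (a *: u + v)) ->
  forall v, v \in span S -> P v.
Proof.
move=> P0 PD v /asboolP[n [c [s [Ss ->]]]].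
elim: n c s Ss => [|n IHn] c s Ss; first by rewrite big_ord0.
by rewrite big_ord_recl; apply: PD => //; apply: IHn.
Qed.

End Span.

Section LinFun.
Variables (k : fieldType) (U V W : lmodType k).

Definition lin_fun (f : U -> V) & linear f := f.
HB.instance Definition _ f (lf : linear f) :=
  GRing.isLinear.Build k U V _ (lin_fun lf) lf.

Definition bilin (f : U -> V -> W) : Prop :=
  (forall v, linear (f^~ v)) /\ (forall u, linear (f u)).

Definition bilin_fun (f : U -> V -> W) & bilin f := f.
Fact bilin_fun_subproof f (bf : bilin f) :
  bilinear_for *:%R *:%R (bilin_fun bf).
Proof. by case: bf. Qed.
HB.instance Definition _ f (bf : bilin f) :=
  bilinear_isBilinear.Build k U V W _ _ (bilin_fun bf) (bilin_fun_subproof bf).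

Lemma bilinearP (f : {bilinear U -> V -> W}) : bilin f.
Proof.
by split=> [v|u] a x y; [rewrite linearDl linearZl_LR | rewrite linearDr linearZr_LR].
Qed.

End LinFun.

Section QuotientModule.
Variables (k : fieldType) (V : lmodType k) (S : set V).

Definition lquot := Quotient.quot (span S).
HB.instance Definition _ := GRing.Zmodule.on lquot.

Definition lproj (v : V) : lquot := \pi v.
Definition lrepr (x : lquot) : V := repr x.

Lemma lreprK x : lproj (lrepr x) = x. Proof. exact: reprK. Qed.

Lemma lprojE v w : lproj v = lproj w <-> v - w \in span S.
Proof. by rewrite Quotient.idealrBE; split=> /eqP. Qed.

Lemma lprojD v w : lproj (v + w) = lproj v + lproj w.
Proof. by rewrite /lproj !piE. Qed.

Definition lquot_scale (a : k) (x : lquot) := lproj (a *: lrepr x).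

Lemma lquot_scaleE a v : lquot_scale a (lproj v) = lproj (a *: v).
Proof.
apply/lprojE; rewrite -scalerBr rpredZ //; apply/lprojE.
exact: lreprK.
Qed.

Lemma lquot_scaleA a b x : lquot_scale a (lquot_scale b x) = lquot_scale (a * b) x.
Proof. by rewrite -(lreprK x) !lquot_scaleE scalerA. Qed.
Lemma lquot_scale1 x : lquot_scale 1 x = x.
Proof. by rewrite -(lreprK x) !lquot_scaleE scale1r. Qed.
Lemma lquot_scaleDr a x y : lquot_scale a (x + y) = lquot_scale a x + lquot_scale a y.
Proof.
by rewrite -(lreprK x) -(lreprK y) !lquot_scaleE -!lprojD lquot_scaleE scalerDr.
Qed.
Lemma lquot_scaleDl x a b : lquot_scale (a + b) x = lquot_scale a x + lquot_scale b x.
Proof. by rewrite -(lreprK x) !lquot_scaleE -!lprojD scalerDl. Qed.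

HB.instance Definition _ := GRing.Zmodule_isLmodule.Build k lquot
  lquot_scaleA lquot_scale1 lquot_scaleDr lquot_scaleDl.

Fact lproj_linear : linear lproj.
Proof. by move=> a v w; rewrite lprojD -lquot_scaleE. Qed.
HB.instance Definition _ := GRing.isLinear.Build k V lquot _ lproj lproj_linear.

End QuotientModule.

Arguments lproj {k V} S v.
Arguments lrepr {k V S} x.

Section Tensor.
Variables (k : fieldType) (U V : lmodType k).

Definition tens_rel : set {freeg (U * V) / k} := [set w |
  (exists a u u' v,
     w = << (a *: u + u', v) >> - (a *: << (u, v) >> + << (u', v) >>)) \/
  (exists a u v v',
     w = << (u, a *: v + v') >> - (a *: << (u, v) >> + << (u, v') >>))].

Definition tens := lquot tens_rel.
HB.instance Definition _ := GRing.Lmodule.on tens.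

Definition tpure (u : U) (v : V) : tens := lproj tens_rel << (u, v) >>.

Lemma tpure_bilin : bilin tpure.
Proof.
by split=> [v|u] a x y /=; rewrite -linearP; apply/lprojE/span_gen;
  [left; exists a, x, y, v | right; exists a, u, x, y].
Qed.

Lemma tpureDl u u' v : tpure (u + u') v = tpure u v + tpure u' v.
Proof. by have := tpure_bilin.1 v 1 u u'; rewrite !scale1r. Qed.
Lemma tpureDr u v v' : tpure u (v + v') = tpure u v + tpure u v'.
Proof. by have := tpure_bilin.2 u 1 v v'; rewrite !scale1r. Qed.
Lemma tpure0l v : tpure 0 v = 0.
Proof. by apply/(addrI (tpure 0 v)); rewrite -tpureDl !addr0. Qed.
Lemma tpure0r u : tpure u 0 = 0.
Proof. by apply/(addrI (tpure u 0)); rewrite -tpureDr !addr0. Qed.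
Lemma tpureZl a u v : tpure (a *: u) v = a *: tpure u v.
Proof. by have := tpure_bilin.1 v a u 0; rewrite tpure0l !addr0. Qed.
Lemma tpureZr a u v : tpure u (a *: v) = a *: tpure u v.
Proof. by have := tpure_bilin.2 u a v 0; rewrite tpure0r !addr0. Qed.

Lemma tens_ind (P : tens -> Prop) :
    (forall u v, P (tpure u v)) -> (forall s t, P s -> P t -> P (s + t)) ->
  forall t, P t.
Proof.
move=> Pp PD t; rewrite -(lreprK t) -(freeg_sumE (lrepr t)).
rewrite linear_sum; apply: (big_ind P) => [|//|[u v] _].
  by rewrite -(tpure0l 0).
suff -> : << coeff (u, v) (lrepr t) *g (u, v) >> =
    coeff (u, v) (lrepr t) *: << (u, v) >> :> {freeg (U * V) / k}.
  by rewrite linearZ -[X in P X]tpureZl.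
by apply/eqP/freeg_eqP => x; rewrite coeffZ !coeffU mul1r.
Qed.

End Tensor.

Notation "u '⊗' v" := (tpure u v) (at level 40, left associativity) : ring_scope.

Section Lift.
Variables (k : fieldType) (U V W : lmodType k) (f : U -> V -> W).

(* Meaningful for bilinear f only: then it is the unique linear map sending   *)
(* u ⊗ v to f u v (tliftE).                                                   *)
Definition tlift (t : tens U V) : W := fglift (fun p => f p.1 p.2) (lrepr t).

Hypothesis bf : bilin f.

Let g : {freeg (U * V) / k} -> W := fglift (fun p => f p.1 p.2).

Let gB x y : g (x - y) = g x - g y. Proof. exact: lift_is_additive. Qed.
Let gN x : g (- x) = - g x.
Proof.
have g0 : g 0 = 0 by rewrite -(subrr 0) gB subrr.
by rewrite -[- x]add0r gB g0 add0r.
Qed.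
Let gD x y : g (x + y) = g x + g y.
Proof. by rewrite -{1}(opprK y) gB gN opprK. Qed.
Let gZ a x : g (a *: x) = a *: g x.
Proof.
have g0 : g 0 = 0 by rewrite -(subrr 0) gB subrr.
have sumg (F : U * V -> {freeg (U * V) / k}) s :
  g (\sum_(z <- s) F z) = \sum_(z <- s) g (F z).
  exact: (big_morph g gD g0).
rewrite -{2}[x]freeg_sumE [a *: x]/(fgscale a x) /fgscale !sumg scaler_sumr.
by apply: eq_bigr => z _; rewrite /g !liftU scalerA.
Qed.

Lemma tlift_rel x : x \in span (@tens_rel k U V) -> g x = 0.
Proof.
elim/span_ind => [|a u v Ru gv]; first by rewrite -(subrr 0) gB subrr.
rewrite gD gZ gv addr0.
suff -> : g u = 0 by rewrite scaler0.
case: Ru => -[b [w [w' [w'' ->]]]]; rewrite gB gD gZ /g !liftU !scale1r /=.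
  by rewrite bf.1 subrr.
by rewrite bf.2 subrr.
Qed.

Lemma tlift_proj x : tlift (lproj _ x) = g x.
Proof.
apply/eqP; rewrite -subr_eq0 -[_ == 0]/(_ == _).
have : lrepr (lproj (@tens_rel k U V) x) - x \in span (@tens_rel k U V).
  by apply/lprojE; rewrite lreprK.
by move/tlift_rel; rewrite gB => /eqP.
Qed.

Lemma tliftE u v : tlift (u ⊗ v) = f u v.
Proof. by rewrite tlift_proj /g liftU scale1r. Qed.

Lemma tlift_linear : linear tlift.
Proof.
by move=> a s t; rewrite -(lreprK s) -(lreprK t) -linearP !tlift_proj gD gZ.
Qed.

Lemma tliftD s t : tlift (s + t) = tlift s + tlift t.
Proof. by have := tlift_linear 1 s t; rewrite !scale1r. Qed.

End Lift.

Lemma tens_eq (k : fieldType) (U V W : lmodType k) (f g : tens U V -> W) :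
  linear f -> linear g -> (forall u v, f (u ⊗ v) = g (u ⊗ v)) -> f =1 g.
Proof.
move=> lf lg fg; elim/tens_ind=> // s t fs ft.
by rewrite -[s]scale1r lf lg fs ft.
Qed.

Section TensMap.
Variables (k : fieldType).

Section Map.
Variables (U U' V V' : lmodType k) (f : {linear U -> U'}) (g : {linear V -> V'}).

Fact tmap_bilin : bilin (fun u v => f u ⊗ g v).
Proof.
by split=> [v|u] a x y; rewrite linearP ?tpureDl ?tpureZl ?tpureDr ?tpureZr.
Qed.

Definition tmap : tens U V -> tens U' V' := tlift (fun u v => f u ⊗ g v).

HB.instance Definition _ :=
  GRing.isLinear.Build k (tens U V) (tens U' V') _ tmap (tlift_linear tmap_bilin).

Lemma tmapE u v : tmap (u ⊗ v) = f u ⊗ g v.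
Proof. exact: (tliftE tmap_bilin). Qed.

End Map.

Section Assoc.
Variables (U V W : lmodType k).

Fact tassoc_bilin1 w : bilin (fun u v => u ⊗ (v ⊗ w) : tens U (tens V W)).
Proof.
by split=> [v|u] a x y; rewrite ?(tpureDl, tpureZl) ?(tpureDr, tpureZr).
Qed.
Fact tassoc_bilin2 :
  bilin (fun s w => tlift (fun u v => u ⊗ (v ⊗ w) : tens U (tens V W)) s).
Proof.
split=> [w|s] a x y; first exact: (tlift_linear (tassoc_bilin1 w)).
elim/tens_ind: s => [u v|s t IHs IHt].
  by rewrite !(tliftE (tassoc_bilin1 _)) !(tpureDr, tpureZr).
by rewrite !(tliftD (tassoc_bilin1 _)) IHs IHt scalerDr addrACA.
Qed.

Definition tassoc : tens (tens U V) W -> tens U (tens V W) :=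
  tlift (fun s w => tlift (fun u v => u ⊗ (v ⊗ w)) s).

HB.instance Definition _ :=
  GRing.isLinear.Build k (tens (tens U V) W) (tens U (tens V W)) _ tassoc
    (tlift_linear tassoc_bilin2).

Lemma tassocE u v w : tassoc (u ⊗ v ⊗ w) = u ⊗ (v ⊗ w).
Proof. by rewrite /tassoc (tliftE tassoc_bilin2) (tliftE (tassoc_bilin1 w)). Qed.

End Assoc.

Section Op2.
Variables (U U' V V' W W' : lmodType k) (f : U -> V -> W) (g : U' -> V' -> W').

(* The product of two bilinear operations: (u ⊗ u', v ⊗ v') |-> f u v ⊗ g u' v' *)
Definition tens2 (s : tens U U') (t : tens V V') : tens W W' :=
  tlift (fun u u' => tlift (fun v v' => f u v ⊗ g u' v') t) s.

Hypotheses (bf : bilin f) (bg : bilin g).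

Let b1 u u' : bilin (fun v v' => f u v ⊗ g u' v').
Proof.
by split=> [v|v'] a x y; rewrite ?bf.2 ?bg.2 ?(tpureDl, tpureZl) ?(tpureDr, tpureZr).
Qed.
Let b2 t : bilin (fun u u' => tlift (fun v v' => f u v ⊗ g u' v') t).
Proof.
split=> [u'|u] a x y; elim/tens_ind: t => [v v'|s t IHs IHt].
- by rewrite !(tliftE (b1 _ _)) bf.1 tpureDl tpureZl.
- by rewrite !(tliftD (b1 _ _)) IHs IHt scalerDr addrACA.
- by rewrite !(tliftE (b1 _ _)) bg.1 tpureDr tpureZr.
- by rewrite !(tliftD (b1 _ _)) IHs IHt scalerDr addrACA.
Qed.

Lemma tens2E u u' v v' : tens2 (u ⊗ u') (v ⊗ v') = f u v ⊗ g u' v'.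
Proof. by rewrite /tens2 (tliftE (b2 _)) (tliftE (b1 _ _)). Qed.

Lemma tens2_bilin : bilin tens2.
Proof.
split=> [t|s] a x y; first exact: (tlift_linear (b2 t)).
elim/tens_ind: s => [u u'|s t IHs IHt].
  by rewrite /tens2 !(tliftE (b2 _)); apply: (tlift_linear (b1 u u')).
by rewrite /tens2 !(tliftD (b2 _)) [LHS](congr2 _ IHs IHt) scalerDr addrACA.
Qed.

End Op2.
End TensMap.


Section Functional.
Variables (k : fieldType) (V : lmodType k) (v : V).
Hypothesis nzv : v != 0.

Let P : set (set V) := [set W | ~ W v /\
  forall (a : k) x y, W x -> W y -> W (a *: x + y)].

Lemma functional_exists : 
  exists f : V -> k, (forall a x y, f (a *: x + y) = a * f x + f y) /\ f v = 1.
Proof.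
have [W [[Wv WP] Wmax]] : exists W, P W /\ forall B, (W `<` B)%classic -> ~ P B.
  apply: Zorn_bigcup => F FP Ftot; split=> [[W FW Wv]|a x y [W FW Wx] [W' FW' Wy]].
    by case: (FP _ FW).
  have [WW'|WW'] := Ftot _ _ FW FW'.
    by exists W' => //; apply: (FP _ FW').2 => //; apply: WW'.
  by exists W => //; apply: (FP _ FW).2 => //; apply: WW'.
have W0 : W 0.
  apply: contrapT => nW0.
  have WE x : ~ W x by move=> Wx; apply: nW0; rewrite -(addNr x) -scaleN1r; exact: WP.
  apply: (Wmax [set 0]).
    by split=> [x /WE//|sub]; apply: nW0; apply: sub.
  split=> [/= v0|a x y /= -> ->]; last by rewrite scaler0 addr0.
  by have := nzv; rewrite v0 eqxx.
have WZ a x : W x -> W (a *: x) by move=> Wx; rewrite -[_ *: _]addr0; exact: WP.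
have WD x y : W x -> W y -> W (x + y) by move=> Wx; rewrite -[x in W (x + _)]scale1r; exact: WP.
have decomp x : exists c, W (x - c *: v).
  have [Wx|nWx] := pselect (W x); first by exists 0; rewrite scale0r subr0.
  apply: contrapT => nc.
  apply: (Wmax [set w | exists a y, W y /\ w = y + a *: x]).
    split=> [w Ww|sub]; first by exists 0, w; rewrite scale0r addr0.
    by apply: nWx; apply: sub; exists 1, 0; rewrite scale1r add0r.
  split=> [[a [y [Wy vE]]]|b _ _ [a [y [Wy ->]]] [a' [y' [Wy' ->]]]].
    have nza : a != 0.
      by apply/eqP => a0; apply: Wv; rewrite vE a0 scale0r addr0.
    apply: nc; exists a^-1; rewrite vE scalerDr scalerA mulVf // scale1r.
    by rewrite opprD addrCA subrr addr0 -scalerN -scaleN1r; do 2!apply: (WZ).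
  exists (b * a + a'), (b *: y + y'); split; first exact: WP.
  by rewrite scalerDr scalerDl scalerA addrACA.
have [f fP] := choice decomp.
have uniq c x : W (x - c *: v) -> f x = c.
  move=> Wc; apply/eqP; rewrite -subr_eq0; apply/negPn/negP => nz; apply: Wv.
  have -> : v = (f x - c)^-1 *: ((x - c *: v) + (-1) *: (x - f x *: v)).
    have -> : (x - c *: v) + (-1) *: (x - f x *: v) = (f x - c) *: v.
      by rewrite scaleN1r opprB addrC addrA subrK -scalerBl.
    by rewrite scalerA mulVf ?scale1r.
  by apply: (WZ); apply: WD => //; apply: (WZ).
exists f; split; last by apply: uniq; rewrite scale1r subrr.
move=> a x y; apply: uniq.
have -> : a *: x + y - (a * f x + f y) *: v = a *: (x - f x *: v) + (y - f y *: v).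
  by rewrite scalerDl scalerBr scalerA opprD addrACA.
exact: WP.
Qed.
End Functional.

Lemma tpure_neq0 (k : fieldType) (U V : lmodType k) (u : U) (v : V) :
  u != 0 -> v != 0 -> u ⊗ v != 0.
Proof.
move=> /functional_exists[f [lf fu]] /functional_exists[g [lg gv]].
have bfg : bilin (fun u v => f u * g v : k^o).
  split=> [y|x] a x1 x2; first by rewrite lf mulrDl -mulrA.
  by rewrite lg mulrDr mulrCA.
apply/eqP => uv0; have := tliftE bfg u v.
rewrite uv0 fu gv mulr1 -(tpure0l U (0 : V)) (tliftE bfg) => /esym.
have f0 : f 0 = 0.
  by apply: (addrI (f 0)); rewrite addr0 -{1}[f 0]mul1r -lf scale1r addr0.
by rewrite f0 mul0r => /eqP; rewrite oner_eq0.
Qed.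

Section AlgTensor.
Variables (k : fieldType) (A B : algType k).
Local Notation T := (tens A B).
Implicit Types s t : T.

Definition tmul : T -> T -> T := tens2 *%R *%R.

Lemma mulr_bilin (C : algType k) : bilin ( *%R : C -> C -> C).
Proof.
by split=> [v|u] a x y; [rewrite mulrDl scalerAl | rewrite mulrDr scalerAr].
Qed.

Lemma tmul_bilin : bilin tmul.
Proof. exact: tens2_bilin (mulr_bilin A) (mulr_bilin B). Qed.

Lemma tmulE a b a' b' : tmul (a ⊗ b) (a' ⊗ b') = (a * a') ⊗ (b * b').
Proof. exact: tens2E (mulr_bilin A) (mulr_bilin B) _ _ _ _. Qed.

Fact tmulDl : left_distributive tmul +%R.
Proof. by move=> s t u; have := tmul_bilin.1 u 1 s t; rewrite !scale1r. Qed.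
Fact tmulDr : right_distributive tmul +%R.
Proof. by move=> s t u; have := tmul_bilin.2 s 1 t u; rewrite !scale1r. Qed.
Fact tmulA : associative tmul.
Proof.
elim/tens_ind=> [a b|s s' IHs IHs'] t u; last by rewrite !tmulDl IHs IHs'.
elim/tens_ind: t => [a' b'|t t' IHt IHt']; last by rewrite !(tmulDl, tmulDr) IHt IHt'.
elim/tens_ind: u => [a'' b''|u u' IHu IHu']; last by rewrite !tmulDr IHu IHu'.
by rewrite !tmulE !mulrA.
Qed.
Fact tmul1l : left_id (1 ⊗ 1) tmul.
Proof.
by elim/tens_ind=> [a b|s t IHs IHt]; rewrite ?tmulDr ?IHs ?IHt // tmulE !mul1r.
Qed.
Fact tmul1r : right_id (1 ⊗ 1) tmul.
Proof.
by elim/tens_ind=> [a b|s t IHs IHt]; rewrite ?tmulDl ?IHs ?IHt // tmulE !mulr1.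
Qed.
Fact tens1_neq0 : (1 : A) ⊗ (1 : B) != 0.
Proof. by apply: tpure_neq0; exact: oner_neq0. Qed.

HB.instance Definition _ := GRing.Zmodule_isNzRing.Build T
  tmulA tmul1l tmul1r tmulDl tmulDr tens1_neq0.

Fact tscaleAl (a : k) s t : a *: (s * t) = (a *: s) * t.
Proof.
have m0 : tmul 0 t = 0 by rewrite -[tmul 0 t]/(0 * t) mul0r.
by have := tmul_bilin.1 t a s 0; rewrite m0 !addr0.
Qed.
HB.instance Definition _ := GRing.Lmodule_isLalgebra.Build k T tscaleAl.
Fact tscaleAr (a : k) s t : a *: (s * t) = s * (a *: t).
Proof.
have m0 : tmul s 0 = 0 by rewrite -[tmul s 0]/(s * 0) mulr0.
by have := tmul_bilin.2 s a t 0; rewrite m0 !addr0.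
Qed.
HB.instance Definition _ := GRing.Lalgebra_isAlgebra.Build k T tscaleAr.

Lemma tensM (a a' : A) (b b' : B) :
  (a ⊗ b) * (a' ⊗ b') = (a * a') ⊗ (b * b').
Proof. exact: tmulE. Qed.
Lemma tens1 : 1 = (1 : A) ⊗ (1 : B).
Proof. by []. Qed.

End AlgTensor.

(* A differential graded algebra is an algebra with an internal grading       *)
(* (a direct sum decomposition into the subspaces deg n) and a differential.  *)
Record dga (k : fieldType) := DGA {
  dga_alg :> algType k;
  deg : nat -> set dga_alg;
  dif : {linear dga_alg -> dga_alg};
  deg_lin : forall n, deg n 0 /\
    forall (a : k) x y, deg n x -> deg n y -> deg n (a *: x + y);
  deg_dec : forall x, exists N (f : nat -> dga_alg),
    (forall n, deg n (f n)) /\ x = \sum_(n < N) f n;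
  deg_indep : forall N (f : nat -> dga_alg), (forall n, deg n (f n)) ->
    \sum_(n < N) f n = 0 -> forall n, (n < N)%N -> f n = 0;
  deg_1 : deg 0 1;
  deg_mul : forall m n x y, deg m x -> deg n y -> deg (m + n) (x * y);
  dif_deg : forall n x, deg n x -> deg n.+1 (dif x);
  dif_dif : forall x, dif (dif x) = 0;
  dif_leibniz : forall n x y, deg n x ->
    dif (x * y) = dif x * y + (-1) ^+ n *: (x * dif y) }.
Arguments deg {k d} n _.
Arguments dif {k d}.

Record dga_morphism (k : fieldType) (X Y : dga k) (f : X -> Y) : Prop := {
  dga_morphism_deg : forall n x, deg n x -> deg n (f x);
  dga_morphism_dif : forall x, f (dif x) = dif (f x) }.

Section Components.
Variables (k : fieldType) (X : dga k).
Implicit Types (x y : X).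

Lemma deg0 n : deg n (0 : X). Proof. by have [] := deg_lin X n. Qed.
Lemma degD n x y : deg n x -> deg n y -> deg n (x + y).
Proof. by rewrite -{2}[x]scale1r; apply: (deg_lin X n).2. Qed.
Lemma degZ n (a : k) x : deg n x -> deg n (a *: x).
Proof. by move=> dx; rewrite -[_ *: x]addr0; apply: (deg_lin X n).2 => //; exact: deg0. Qed.

Definition hbound x : nat := projT1 (cid (deg_dec x)).
Let hfam x : nat -> X := projT1 (cid (projT2 (cid (deg_dec x)))).
Definition hc n x : X := if (n < hbound x)%N then hfam x n else 0.

Let hfamP x : (forall n, deg n (hfam x n)) /\ x = \sum_(n < hbound x) hfam x n.
Proof. exact: (projT2 (cid (projT2 (cid (deg_dec x))))). Qed.

Lemma hc_deg n x : deg n (hc n x).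
Proof. by rewrite /hc; case: ifP => _; [case: (hfamP x) | exact: deg0]. Qed.

Lemma hc_bound n x : (hbound x <= n)%N -> hc n x = 0.
Proof. by rewrite /hc leqNgt => /negbTE ->. Qed.

Let sum_pad (F : nat -> X) N M : (N <= M)%N ->
  \sum_(n < N) F n = \sum_(n < M) (if (n < N)%N then F n else 0).
Proof. by move=> le; rewrite (big_ord_widen M F le) big_mkcond. Qed.

Lemma hc_sum x : x = \sum_(n < hbound x) hc n x.
Proof.
rewrite {1}(hfamP x).2; apply: eq_bigr => n _.
by rewrite /hc ltn_ord.
Qed.

Lemma hc_sum_le x M : (hbound x <= M)%N -> x = \sum_(n < M) hc n x.
Proof.
move=> le; rewrite {1}[x]hc_sum (sum_pad (fun n => hc n x) le); apply: eq_bigr => n _.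
by case: ltnP => // /hc_bound ->.
Qed.

Lemma hc_uniq N (f : nat -> X) n : (forall m, deg m (f m)) ->
  hc n (\sum_(m < N) f m) = if (n < N)%N then f n else 0.
Proof.
move=> df; set x := \sum_(m < N) f m.
pose M := maxn n.+1 (maxn N (hbound x)).
pose f' m := if (m < N)%N then f m else 0.
have df' m : deg m (f' m) by rewrite /f'; case: ifP => // _; exact: deg0.
have xf' : x = \sum_(m < M) f' m.
  by rewrite /x (@sum_pad f _ M) // /M !leq_max leqnn orbT.
have xh : x = \sum_(m < M) hc m x by apply: hc_sum_le; rewrite /M !leq_max leqnn !orbT.
apply/eqP; rewrite -subr_eq0 -/(f' n); apply/eqP.
apply: (deg_indep (N := M) (f := fun m => hc m x - f' m)) => [m||].
- by rewrite addrC -scaleN1r; apply: (deg_lin X m).2 => //; exact: hc_deg.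
- by rewrite sumrB -xh -xf' subrr.
- by rewrite /M leq_max leqnn.
Qed.

Fact hc_linear n : linear (hc n).
Proof.
move=> a x y; pose M := maxn n.+1 (maxn (hbound x) (hbound y)).
have := @hc_uniq M (fun m => a *: hc m x + hc m y) n.
rewrite big_split /= -scaler_sumr -!hc_sum_le ?leq_max ?leqnn ?orbT // => -> //.
by move=> m; apply: (deg_lin X m).2; exact: hc_deg.
Qed.
HB.instance Definition _ n := GRing.isLinear.Build k X X _ (hc n) (hc_linear n).

Lemma hc_id m n x : deg n x -> hc m x = if m == n then x else 0.
Proof.
move=> dx; pose f i := if i == n then x else 0.
have df i : deg i (f i) by rewrite /f; case: eqP => [->|_]; last exact: deg0.
have {1}-> : x = \sum_(i < (maxn m n).+1) f i.
  have lt : (n < (maxn m n).+1)%N by rewrite ltnS leq_maxr.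
  rewrite (bigD1 (Ordinal lt)) //= /f eqxx big1 ?addr0 // => i.
  by rewrite -val_eqE /= => /negbTE ->.
by rewrite hc_uniq // ltnS leq_maxl.
Qed.

Definition hscale (c : nat -> k) x : X := \sum_(n < hbound x) c n *: hc n x.

Lemma hscale_le c x M : (hbound x <= M)%N -> hscale c x = \sum_(n < M) c n *: hc n x.
Proof.
move=> le; rewrite /hscale (sum_pad (fun n => c n *: hc n x) le).
by apply: eq_bigr => n _; case: ltnP => // /hc_bound ->; rewrite scaler0.
Qed.

Fact hscale_linear c : linear (hscale c).
Proof.
move=> a x y.
pose M := maxn (hbound (a *: x + y)) (maxn (hbound x) (hbound y)).
rewrite !(@hscale_le c _ M) ?leq_max ?leqnn ?orbT // scaler_sumr -big_split.
by apply: eq_bigr => n _; rewrite linearP scalerDr !scalerA mulrC.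
Qed.
HB.instance Definition _ c := GRing.isLinear.Build k X X _ (hscale c) (hscale_linear c).

Lemma hscaleE c n x : deg n x -> hscale c x = c n *: x.
Proof.
move=> dx; have le : (hbound x <= (maxn n (hbound x)).+1)%N by rewrite leqW ?leq_maxr.
have lt : (n < (maxn n (hbound x)).+1)%N by rewrite ltnS leq_maxl.
rewrite (hscale_le c le) (bigD1 (Ordinal lt)) //= (hc_id _ dx) eqxx.
rewrite big1 ?addr0 // => i; rewrite -val_eqE /= => /negbTE ne.
by rewrite (hc_id _ dx) ne scaler0.
Qed.

Lemma hom_ind (P : X -> Prop) :
  (forall n x, deg n x -> P x) -> (forall x y, P x -> P y -> P (x + y)) ->
  forall x, P x.
Proof.
move=> Ph PD x; rewrite [x]hc_sum; apply: (big_ind P) => //.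
  by apply: (Ph 0%N); exact: deg0.
by move=> n _; apply: (Ph n); exact: hc_deg.
Qed.

(* The sign x |-> (-1)^|x| x, and the projections to even and odd degrees. *)
Definition hsign : {linear X -> X} := hscale (fun n => (-1) ^+ n).
Definition heven : {linear X -> X} := hscale (fun n => (~~ odd n)%:R).
Definition hodd : {linear X -> X} := hscale (fun n => (odd n)%:R).

End Components.


(* The space X ⊗ Y with the product and differential of the graded tensor     *)
(* product; see gtmulE and gtdifE for the usual formulas.                     *)
Definition gtens_alg (k : fieldType) (X Y : dga k) := tens X Y.
HB.instance Definition _ k X Y := GRing.Lmodule.on (@gtens_alg k X Y).

(* (x ⊗ y)(x' ⊗ y') = x x'_even ⊗ y y' + x x'_odd ⊗ (-1)^|y| y y' *)
HB.lock Definition gtmul (k : fieldType) (X Y : dga k) (s t : gtens_alg X Y) :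
    gtens_alg X Y :=
  tmul s (tmap (heven X) idfun t) +
  tmul (tmap idfun (hsign Y) s) (tmap (hodd X) idfun t).

(* dif ⊗ id + (-1)^|-| id ⊗ dif *)
HB.lock Definition gtdif (k : fieldType) (X Y : dga k) (s : gtens_alg X Y) :
    gtens_alg X Y :=
  tmap dif idfun s + tmap (hsign X) dif s.

Section GradedTensor.
Variables (k : fieldType) (X Y : dga k).
Local Notation T := (gtens_alg X Y).
Local Notation gtmul := (@gtmul k X Y).
Local Notation gtdif := (@gtdif k X Y).
Implicit Types (s t u : T) (x : X) (y : Y).

Definition gtdeg n : set T := fun t => t \in span
  [set w : tens X Y | exists i j x y, [/\ (i + j = n)%N, deg i x, deg j y & w = x ⊗ y]].

Lemma gtmul_bilin : bilin gtmul.
Proof.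
have m := tmul_bilin X Y.
by split=> t a x y; rewrite gtmul.unlock !linearP ?(m.1 _ a) ?(m.2 _ a) scalerDr addrACA.
Qed.

Lemma gtdif_linear : linear gtdif.
Proof. by move=> a x y; rewrite gtdif.unlock !linearP scalerDr addrACA. Qed.
HB.instance Definition _ := GRing.isLinear.Build k T T _ gtdif gtdif_linear.

Lemma gtmulE i j x y x' y' : deg i y -> deg j x' ->
  gtmul (x ⊗ y) (x' ⊗ y') = (-1) ^+ (i * j) *: ((x * x') ⊗ (y * y')).
Proof.
move=> dy dx'; rewrite gtmul.unlock !tmapE !tmulE /= (hscaleE _ dy) !(hscaleE _ dx').
case: (boolP (odd j)) => oj /=.
  rewrite !scale0r mulr0 tpure0l add0r scale1r -scalerAl tpureZr.
  by rewrite -[in RHS]signr_odd oddM oj andbT signr_odd.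
rewrite !scale0r mulr0 tpure0l addr0 scale1r.
by rewrite -signr_odd oddM (negbTE oj) andbF scale1r.
Qed.

Lemma gtdifE i x y : deg i x ->
  gtdif (x ⊗ y) = dif x ⊗ y + (-1) ^+ i *: (x ⊗ dif y).
Proof. by move=> dx; rewrite gtdif.unlock !tmapE /= (hscaleE _ dx) tpureZl. Qed.

Lemma gtens_ind (P : T -> Prop) :
    (forall i j x y, deg i x -> deg j y -> P (x ⊗ y)) ->
    (forall s t, P s -> P t -> P (s + t)) -> forall t, P t.
Proof.
move=> Ph PD; elim/tens_ind => // x y.
elim/hom_ind: x => [i x dx|x x' Px Px']; last by rewrite tpureDl; apply: PD.
elim/hom_ind: y => [j y dy|y y' Py Py']; last by rewrite tpureDr; apply: PD.
exact: Ph dx dy.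
Qed.

Fact gtmulDl : left_distributive gtmul +%R.
Proof. by move=> s t u; have := gtmul_bilin.1 u 1 s t; rewrite !scale1r. Qed.
Fact gtmulDr : right_distributive gtmul +%R.
Proof. by move=> s t u; have := gtmul_bilin.2 s 1 t u; rewrite !scale1r. Qed.
Fact gtmul0l t : gtmul 0 t = 0.
Proof. by apply: (addrI (gtmul 0 t)); rewrite -gtmulDl !addr0. Qed.
Fact gtmul0r t : gtmul t 0 = 0.
Proof. by apply: (addrI (gtmul t 0)); rewrite -gtmulDr !addr0. Qed.
Fact gtmulZl a s t : gtmul (a *: s) t = a *: gtmul s t.
Proof. by have := gtmul_bilin.1 t a s 0; rewrite gtmul0l !addr0. Qed.
Fact gtmulZr a s t : gtmul s (a *: t) = a *: gtmul s t.
Proof. by have := gtmul_bilin.2 s a t 0; rewrite gtmul0r !addr0. Qed.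

Fact gtmulA : associative gtmul.
Proof.
elim/gtens_ind=> [i1 j1 x1 y1 dx1 dy1|s s' IHs IHs'] t u; last first.
  by rewrite !gtmulDl IHs IHs'.
elim/gtens_ind: t => [i2 j2 x2 y2 dx2 dy2|t t' IHt IHt']; last first.
  by rewrite !(gtmulDl, gtmulDr) IHt IHt'.
elim/gtens_ind: u => [i3 j3 x3 y3 dx3 dy3|u u' IHu IHu']; last first.
  by rewrite !gtmulDr IHu IHu'.
rewrite (gtmulE _ _ dy2 dx3) (gtmulE _ _ dy1 dx2) gtmulZl gtmulZr.
rewrite (gtmulE _ _ dy1 (deg_mul dx2 dx3)) (gtmulE _ _ (deg_mul dy1 dy2) dx3).
rewrite !scalerA !mulrA -!exprD; congr (_ ^+ _ *: _).
by rewrite mulnDl mulnDr addnCA [(j2 * _ + _)%N]addnC.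
Qed.

Fact gtmul1l : left_id (1 ⊗ 1) gtmul.
Proof.
elim/gtens_ind=> [i j x y dx dy|s t IHs IHt]; last by rewrite gtmulDr IHs IHt.
by rewrite (gtmulE _ _ (deg_1 Y) dx) mul0n scale1r !mul1r.
Qed.
Fact gtmul1r : right_id (1 ⊗ 1) gtmul.
Proof.
elim/gtens_ind=> [i j x y dx dy|s t IHs IHt]; last by rewrite gtmulDl IHs IHt.
by rewrite (gtmulE _ _ dy (deg_1 X)) muln0 scale1r !mulr1.
Qed.

HB.instance Definition _ := GRing.Zmodule_isNzRing.Build T
  gtmulA gtmul1l gtmul1r gtmulDl gtmulDr (tens1_neq0 X Y).
HB.instance Definition _ := GRing.Lmodule_isLalgebra.Build k T
  (fun a s t => esym (gtmulZl a s t)).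
HB.instance Definition _ := GRing.Lalgebra_isAlgebra.Build k T
  (fun a s t => esym (gtmulZr a s t)).

Fact gtdeg_lin n : gtdeg n 0 /\
  forall (a : k) s t, gtdeg n s -> gtdeg n t -> gtdeg n (a *: s + t).
Proof.
split; first exact: rpred0.
by move=> a s t ds dt; apply: rpredD => //; apply: rpredZ.
Qed.

Fact gtdeg_pure i j x y : deg i x -> deg j y -> gtdeg (i + j) (x ⊗ y).
Proof. by move=> dx dy; apply: span_gen; exists i, j, x, y. Qed.

Lemma gtdeg_ind n (P : T -> Prop) : P 0 ->
    (forall a i j x y t, (i + j = n)%N -> deg i x -> deg j y -> P t ->
       P (a *: (x ⊗ y : T) + t)) ->
  forall t, gtdeg n t -> P t.
Proof.
move=> P0 PD; apply: span_ind => // a _ t [i [j [x [y [ij dx dy ->]]]]] Pt.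
exact: (PD a i j x y t ij dx dy Pt).
Qed.

Fact gtdeg_dec t : exists N (f : nat -> T),
  (forall n, gtdeg n (f n)) /\ t = \sum_(n < N) f n.
Proof.
elim/gtens_ind: t => [i j x y dx dy|s t [N [f [df ->]]] [M [g [dg ->]]]].
  exists (i + j).+1, (fun n => if n == (i + j)%N then x ⊗ y else 0); split=> [n|].
    by case: eqP => [->|_]; [exact: gtdeg_pure | exact: (gtdeg_lin n).1].
  rewrite big_ord_recr /= eqxx big1 ?add0r // => n _.
  by rewrite ltn_eqF.
exists (maxn N M), (fun n => (if (n < N)%N then f n else 0) +
                             (if (n < M)%N then g n else 0)); split=> [n|].
  rewrite -[X in X + _]scale1r; apply: (gtdeg_lin n).2; case: ifP => // _;
    exact: (gtdeg_lin n).1.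
rewrite big_split /= -!big_mkcond /=.
by rewrite -!(big_ord_widen (maxn N M) _) ?leq_maxl ?leq_maxr.
Qed.

Let proj n (t : T) : T := \sum_(i < n.+1) tmap (hc i) (hc (n - i)) t.

Let proj_lin n : linear (proj n).
Proof.
move=> a s t; rewrite /proj scaler_sumr -big_split; apply: eq_bigr => i _.
exact: linearP.
Qed.

Let projE n m t : gtdeg m t -> proj n t = if n == m then t else 0.
Proof.
move: t; apply: gtdeg_ind => [|a i j x y t ij dx dy IH].
  by rewrite /proj big1 ?if_same // => i _; rewrite linear0.
rewrite proj_lin IH; case: (eqVneq n m) => [nm|nm]; last first.
  rewrite addr0 /proj big1 ?scaler0 // => l _.
  rewrite tmapE /= (hc_id _ dx) (hc_id _ dy).
  case: eqP => [li|_]; last exact: tpure0l.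
  case: eqP => [lj|_]; last exact: tpure0r.
  case/eqP: nm; rewrite -ij -li -lj subnKC // -ltnS; exact: ltn_ord.
congr (_ *: _ + _); rewrite /proj.
have lt : (i < n.+1)%N by rewrite ltnS nm -ij leq_addr.
rewrite (bigD1 (Ordinal lt)) //= tmapE /= (hc_id _ dx) (hc_id _ dy) eqxx.
have -> : (n - i == j)%N by rewrite nm -ij addKn.
rewrite big1 ?addr0 // => l; rewrite -val_eqE /= => /negbTE ne.
by rewrite tmapE /= (hc_id _ dx) ne tpure0l.
Qed.

Fact gtdeg_indep N (f : nat -> T) : (forall n, gtdeg n (f n)) ->
  \sum_(n < N) f n = 0 -> forall n, (n < N)%N -> f n = 0.
Proof.
move=> df sf0 n lt; have proj0 m : proj m 0 = 0.
  by rewrite /proj big1 // => i _; rewrite linear0.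
have projD m s t : proj m (s + t) = proj m s + proj m t.
  by have := proj_lin m 1 s t; rewrite !scale1r.
have := proj0 n; rewrite -sf0 (big_morph _ (projD n) (proj0 n)).
rewrite (bigD1 (Ordinal lt)) //= (projE _ (df n)) eqxx big1 ?addr0 // => i.
by rewrite -val_eqE /= eq_sym => /negbTE ne; rewrite (projE _ (df i)) ne.
Qed.

Fact gtdeg_mul m n s t : gtdeg m s -> gtdeg n t -> gtdeg (m + n) (s * t).
Proof.
have lin := gtdeg_lin (m + n).
move=> + dt; move: s; apply: gtdeg_ind => [|a i j x y s ij dx dy IH].
  by rewrite mul0r; exact: lin.1.
rewrite mulrDl -scalerAl; apply: lin.2 => // {s IH}.
move: t dt; apply: gtdeg_ind => [|b i' j' x' y' t ij' dx' dy' IH].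
  by rewrite mulr0; exact: lin.1.
rewrite mulrDr -scalerAr; apply: lin.2 => //.
rewrite -[_ * _]/(gtmul _ _) (gtmulE _ _ dy dx') -[_ *: _]addr0.
apply: lin.2; last exact: lin.1.
by rewrite -ij -ij' addnACA; apply: gtdeg_pure; exact: deg_mul.
Qed.

Fact gtdif_deg n t : gtdeg n t -> gtdeg n.+1 (gtdif t).
Proof.
have lin := gtdeg_lin n.+1.
move: t; apply: gtdeg_ind => [|a i j x y s ij dx dy IH].
  by rewrite linear0; exact: lin.1.
rewrite linearP /=; apply: lin.2 => //; rewrite (gtdifE _ dx) addrC.
apply: lin.2; rewrite -ij; last by rewrite -addSn; apply/gtdeg_pure/dy/dif_deg.
by rewrite -addnS; apply/gtdeg_pure/dif_deg.
Qed.

Fact gtdif_dif t : gtdif (gtdif t) = 0.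
Proof.
elim/gtens_ind: t => [i j x y dx dy|s t IHs IHt]; last first.
  by rewrite !linearD /= IHs IHt addr0.
rewrite (gtdifE _ dx) linearD linearZ /= (gtdifE _ dx) (gtdifE _ (dif_deg dx)) /=.
rewrite !dif_dif tpure0l tpure0r add0r scaler0 addr0 -scalerDl.
by rewrite exprS mulN1r addNr scale0r.
Qed.

Fact gtdif_leibniz n s t : gtdeg n s ->
  gtdif (s * t) = gtdif s * t + (-1) ^+ n *: (s * gtdif t).
Proof.
move: s; apply: gtdeg_ind => [|a i j x y s ij dx dy IH].
  by rewrite linear0 !mul0r linear0 scaler0 addr0.
rewrite mulrDl -scalerAl !linearP /= IH !mulrDl -!scalerAl [_ *: (_ *: _ + _)]scalerDr.
rewrite addrACA; congr (_ + _).
rewrite scalerA [_ * a]mulrC -scalerA -scalerDr; congr (_ *: _) => {s IH a}.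
elim/gtens_ind: t => [i' j' x' y' dx' dy'|s t IHs IHt]; last first.
  rewrite mulrDr !linearD /= !mulrDr IHs IHt; rewrite scalerDr.
  by rewrite addrACA.
have E a b : a * b = gtmul a b by [].
rewrite !E (gtdifE _ dx) (gtdifE _ dx') !gtmulDl !gtmulDr !gtmulZl !gtmulZr.
rewrite !(gtmulE _ _ dy dx') (gtmulE _ _ dy (dif_deg dx')).
rewrite (gtmulE _ _ (dif_deg dy) dx') linearZ /= (gtdifE _ (deg_mul dx dx')).
rewrite (dif_leibniz _ dx) (dif_leibniz _ dy) tpureDl tpureDr tpureZl tpureZr.
rewrite !scalerDr !scalerA -!exprD -ij.
have -> : (i + j.+1 * i' = j * i' + (i + i'))%N by rewrite mulSn addnA addnC.
have -> : (i + j + i' + j * i' = j * i' + (i + i') + j)%N.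
  by rewrite addnC (addnAC i) addnA.
have -> : (-1) ^+ (i + j + j * i'.+1) = (-1) ^+ (j * i' + i) :> k.
  rewrite mulnS addnA -(addnA i) addnn addnAC addnC -[LHS]signr_odd oddD odd_double addFb.
  by rewrite signr_odd addnC.
by rewrite addrACA.
Qed.

Definition gtens : dga k := DGA (dif := gtdif : {linear T -> T})
  gtdeg_lin gtdeg_dec gtdeg_indep (gtdeg_pure (deg_1 X) (deg_1 Y)) gtdeg_mul
  gtdif_deg gtdif_dif gtdif_leibniz.

End GradedTensor.

Section Modules.
Variables (k : fieldType) (R : algType k).

Record lmodule := LModule {
  lmod_car :> lmodType k;
  lact : {bilinear R -> lmod_car -> lmod_car};
  lact1 : forall m, lact 1 m = m;
  lactM : forall r s m, lact (r * s) m = lact r (lact s m) }.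

Arguments lact {_}.

Record rmodule := RModule {
  rmod_car :> lmodType k;
  ract : {bilinear rmod_car -> R -> rmod_car};
  ract1 : forall m, ract m 1 = m;
  ractM : forall r s m, ract m (r * s) = ract (ract m r) s }.

Arguments ract {_}.

Record bimodule := Bimodule {
  bimod_l :> lmodule;
  bimod_ract : {bilinear bimod_l -> R -> bimod_l};
  bimod_ract1 : forall m, bimod_ract m 1 = m;
  bimod_ractM : forall r s m, bimod_ract m (r * s) = bimod_ract (bimod_ract m r) s;
  bimod_lractA : forall r m s, lact r (bimod_ract m s) = bimod_ract (lact r m) s }.

Arguments bimod_ract {_}.

Definition bimod_r (M : bimodule) : rmodule :=
  RModule (bimod_ract1 (b := M)) (@bimod_ractM M).

Definition regular_lmodule : lmodule :=
  LModule (lact := bilin_fun (mulr_bilin R)) (@mul1r R) (fun r s m => esym (mulrA r s m)).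

Definition requivariant (M M' : rmodule) (f : M -> M') : Prop :=
  forall m r, f (ract m r) = ract (f m) r.

(* The tensor product over R: M ⊗ N modulo the relations m r ⊗ n = m ⊗ r n. *)
Section BalancedTensor.
Variables (M : rmodule) (N : lmodule).

Definition btens_rel : set (tens M N) := [set t |
  exists m r n, t = ract m r ⊗ n - m ⊗ lact r n].

Definition btens := lquot btens_rel.
HB.instance Definition _ := GRing.Lmodule.on btens.

Definition btpure (m : M) (n : N) : btens := lproj btens_rel (m ⊗ n).

Lemma btpure_bilin : bilin btpure.
Proof.
by split=> [n|m] a x y; rewrite -linearP; congr (lproj _ _);
  [apply: (tpure_bilin M N).1 | apply: (tpure_bilin M N).2].
Qed.

Lemma btpureA m r n : btpure (ract m r) n = btpure m (lact r n).
Proof. by apply/lprojE/span_gen; exists m, r, n. Qed.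

Lemma btens_ind (P : btens -> Prop) :
    (forall m n, P (btpure m n)) -> (forall s t, P s -> P t -> P (s + t)) ->
  forall t, P t.
Proof.
move=> Pp PD t; rewrite -(lreprK t).
by elim/tens_ind: (lrepr t) => // x y Px Py; rewrite linearD; apply: PD.
Qed.

(* Meaningful for balanced bilinear f, see btliftE. *)
Definition btlift (W : lmodType k) (f : M -> N -> W) (t : btens) : W :=
  tlift f (lrepr t).

Section BalancedLift.
Variables (W : lmodType k) (f : M -> N -> W).
Hypotheses (bf : bilin f) (balf : forall m r n, f (ract m r) n = f m (lact r n)).

Lemma btlift_proj t : btlift f (lproj _ t) = tlift f t.
Proof.
pose g : {linear tens M N -> W} := lin_fun (tlift_linear bf).
apply/eqP; rewrite -subr_eq0; apply/eqP.
have : lrepr (lproj btens_rel t) - t \in span btens_rel.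
  by apply/lprojE; rewrite lreprK.
rewrite -[LHS](linearB g); move: (_ - t); apply: span_ind.
  exact: (linear0 g).
move=> a _ u [m [r [n ->]]] gu; rewrite (linearP g) gu addr0 (linearB g) /=.
rewrite [X in _ *: (X - _)](tliftE bf) [X in _ *: (_ - X)](tliftE bf).
by rewrite balf subrr scaler0.
Qed.

Lemma btliftE m n : btlift f (btpure m n) = f m n.
Proof. by rewrite btlift_proj (tliftE bf). Qed.

Lemma btlift_linear : linear (btlift f).
Proof.
move=> a s t; rewrite -(lreprK s) -(lreprK t) -linearP !btlift_proj.
exact: tlift_linear.
Qed.

Lemma btliftD s t : btlift f (s + t) = btlift f s + btlift f t.
Proof. by have := btlift_linear 1 s t; rewrite !scale1r. Qed.

End BalancedLift.
End BalancedTensor.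

Definition btmapl (M M' : rmodule) (N : lmodule) (f : M -> M') :
  btens M N -> btens M' N := btlift (fun m n => btpure (f m) n).

Definition exact_pair (U V W : lmodType k) (f : U -> V) (g : V -> W) : Prop :=
  forall v, g v = 0 <-> exists u, f u = v.

(* For a left module N: the functor - ⊗_R N preserves and reflects exactness. *)
Definition faithfully_flat (N : lmodule) : Prop :=
  forall (M' M M'' : rmodule) (f : {linear M' -> M}) (g : {linear M -> M''}),
    requivariant f -> requivariant g ->
    exact_pair f g <-> exact_pair (btmapl (N := N) f) (btmapl (N := N) g).

(* For a bimodule M the space M ⊗_R N is again a left module. *)
Section BalancedTensorModule.
Variables (M : bimodule) (N : lmodule).
Local Notation T := (btens (bimod_r M) N).

Definition bt_lact (r : R) : T -> T :=
  btlift (fun (m : bimod_r M) (n : N) => btpure (lact r (m : M) : bimod_r M) n).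

Fact bt_lact_bilin1 r :
  bilin (fun (m : bimod_r M) (n : N) => btpure (lact r (m : M) : bimod_r M) n).
Proof.
have b := btpure_bilin (bimod_r M) N; have lb := bilinearP (@lact M).
split=> [n|m] a x y; last exact: b.2.
by rewrite lb.2; apply: b.1.
Qed.
Fact bt_lact_bal r (m : bimod_r M) s (n : N) :
  btpure (lact r (ract m s : M) : bimod_r M) n
  = btpure (lact r (m : M) : bimod_r M) (lact s n).
Proof. by rewrite -btpureA /= bimod_lractA. Qed.

Lemma bt_lactE r (m : bimod_r M) (n : N) :
  bt_lact r (btpure m n) = btpure (lact r (m : M) : bimod_r M) n.
Proof. exact: (btliftE (bt_lact_bilin1 r) (bt_lact_bal r)). Qed.

Fact bt_lactD r s t : bt_lact r (s + t) = bt_lact r s + bt_lact r t.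
Proof. exact: (btliftD (bt_lact_bilin1 r) (bt_lact_bal r)). Qed.

Fact bt_lact_bilin : bilin bt_lact.
Proof.
have b := btpure_bilin (bimod_r M) N; have lb := bilinearP (@lact M).
split=> [t|r] a x y; last exact: (btlift_linear (bt_lact_bilin1 r) (bt_lact_bal r)).
elim/btens_ind: t => [m n|s t IHs IHt].
  by rewrite !bt_lactE lb.1; apply: b.1.
by rewrite !bt_lactD IHs IHt scalerDr addrACA.
Qed.

Fact bt_lact1 t : bt_lact 1 t = t.
Proof.
elim/btens_ind: t => [m n|s t IHs IHt]; first by rewrite bt_lactE lact1.
by rewrite bt_lactD IHs IHt.
Qed.

Fact bt_lactM r s t : bt_lact (r * s) t = bt_lact r (bt_lact s t).
Proof.
elim/btens_ind: t => [m n|x y IHs IHt]; first by rewrite !bt_lactE lactM.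
by rewrite !bt_lactD IHs IHt.
Qed.

Definition btens_lmodule : lmodule :=
  LModule (lact := bilin_fun bt_lact_bilin) bt_lact1 bt_lactM.

End BalancedTensorModule.

(* tpow M n = M ⊗_R (M ⊗_R ... (M ⊗_R R)), the degree n part of the tensor    *)
(* algebra of M over R.                                                       *)
Fixpoint tpow (M : bimodule) (n : nat) : lmodule :=
  if n is n'.+1 then btens_lmodule M (tpow M n') else regular_lmodule.

Definition tcons (M : bimodule) n (m : M) (t : tpow M n) : tpow M n.+1 :=
  btpure (m : bimod_r M) t.

(* The product tpow M m x tpow M n -> tpow M (m + n) of the tensor algebra *)
Fixpoint tpmul (M : bimodule) (m n : nat) :
    tpow M m -> tpow M n -> tpow M (m + n) :=
  match m return tpow M m -> tpow M n -> tpow M (m + n) with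
  | 0 => fun r t => lact (r : R) t
  | m'.+1 => fun s t => btlift (fun (x : bimod_r M) s' => tcons x (tpmul s' t))
                          (s : btens (bimod_r M) (tpow M m'))
  end.

Lemma tpmul_spec (M : bimodule) m n (t : tpow M n) :
  (linear (fun s : tpow M m => tpmul s t)) /\
  (forall r (s : tpow M m), tpmul (lact r s) t = lact r (tpmul s t)).
Proof.
elim: m => [|m [lin eqv]].
  by split=> [a x y|r s] /=; [exact: (bilinearP (@lact (tpow M n))).1 | exact: lactM].
have b := btpure_bilin (bimod_r M) (tpow M (m + n)).
have bf : bilin (fun (x : bimod_r M) (s : tpow M m) => tcons x (tpmul s t)).
  split=> [s|x] a u v; first exact: b.1.
  by rewrite /tcons lin; apply: b.2.
have balf (x : bimod_r M) r (s : tpow M m) :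
    tcons (ract x r : M) (tpmul s t) = tcons x (tpmul (lact r s) t).
  by rewrite eqv; apply: btpureA.
have D (u v : tpow M m.+1) : tpmul (u + v) t = tpmul u t + tpmul v t.
  exact: (btliftD bf balf u v).
have E (x : bimod_r M) (s : tpow M m) : tpmul (tcons x s) t = tcons x (tpmul s t).
  exact: (btliftE bf balf x s).
split=> [a x y|r s]; first exact: (btlift_linear bf balf).
elim/btens_ind: s => [x s|u v IHu IHv].
  by rewrite [lact r _]bt_lactE E -/(tcons x s) E [RHS]bt_lactE.
by rewrite linearDr !D [RHS]linearDr IHu IHv.
Qed.

Lemma tpmul_tcons (M : bimodule) m n (x : M) (s : tpow M m) (t : tpow M n) :
  tpmul (tcons x s) t = tcons x (tpmul s t).
Proof.
have [lin eqv] := tpmul_spec m t.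
have b := btpure_bilin (bimod_r M) (tpow M (m + n)).
have bf : bilin (fun (x : bimod_r M) (s : tpow M m) => tcons x (tpmul s t)).
  split=> [u|u] a v w; first exact: b.1.
  by rewrite /tcons lin; apply: b.2.
apply: (btliftE bf) => y r u; rewrite eqv; exact: btpureA.
Qed.

End Modules.
Arguments lact {k R _}.
Arguments ract {k R _}.
Arguments bimod_ract {k R _}.

Record hopf (k : fieldType) := Hopf {
  hopf_alg :> algType k;
  cop : {lrmorphism hopf_alg -> tens hopf_alg hopf_alg};
  cou : {lrmorphism hopf_alg -> k^o};
  antip : {linear hopf_alg -> hopf_alg};
  cop_coassoc : forall h, tassoc (tmap cop idfun (cop h)) = tmap idfun cop (cop h);
  cop_counitl : forall h, tlift (fun a b => (cou a : k) *: b) (cop h) = h;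
  cop_counitr : forall h, tlift (fun a b => (cou b : k) *: a) (cop h) = h;
  antip_l : forall h, tlift (fun a b => antip a * b) (cop h) = (cou h : k) *: 1;
  antip_r : forall h, tlift (fun a b => a * antip b) (cop h) = (cou h : k) *: 1 }.
Arguments cop {k _}.
Arguments cou {k _}.

Section Comodules.
Variables (k : fieldType) (H : hopf k).

Definition right_coaction (V : lmodType k) (rho : {linear V -> tens V H}) : Prop :=
  (forall v, tassoc (tmap rho idfun (rho v)) = tmap idfun cop (rho v)) /\
  (forall v, tlift (fun u h => (cou h : k) *: u) (rho v) = v).

Definition left_coaction (V : lmodType k) (lam : {linear V -> tens H V}) : Prop :=
  (forall v, tassoc (tmap cop idfun (lam v)) = tmap idfun lam (lam v)) /\
  (forall v, tlift (fun h u => (cou h : k) *: u) (lam v) = v).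

Record comodule_algebra := ComoduleAlgebra {
  coma_alg :> algType k;
  coact : {lrmorphism coma_alg -> tens coma_alg H};
  coact_coaction : right_coaction coact }.
Arguments coact {_}.

Section QuantumPrincipalBundle.
Variable A : comodule_algebra.

Definition coinv_pred : {pred A} := fun a => `[< coact a = a ⊗ 1 >].

Fact coinv_closed : GRing.subsemialg_closed coinv_pred.
Proof.
apply: GRing.subalg_closed_semi; split.
- by apply/asboolP; rewrite rmorph1.
- move=> a u v /asboolP cu /asboolP cv; apply/asboolP.
  by rewrite linearP /= cu cv tpureDl tpureZl.
- move=> u v /asboolP cu /asboolP cv; apply/asboolP.
  by rewrite rmorphM /= cu cv tensM mulr1.
Qed.
HB.instance Definition _ := GRing.isSubalgClosed.Build k A coinv_pred coinv_closed.

(* The algebra B = A^{coH} of coinvariants *)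
Record coinv := Coinv { coinv_val : A; _ : coinv_val \in coinv_pred }.
HB.instance Definition _ := [isSub for coinv_val].
HB.instance Definition _ := [Choice of coinv by <:].
HB.instance Definition _ := [SubChoice_isSubAlgebra of coinv by <:].

Fact coinv_lact_bilin : bilin (fun (b : coinv) (a : A) => coinv_val b * a).
Proof.
have m := mulr_bilin A; split=> [a|b] c x y; last exact: m.2.
by rewrite -[coinv_val _]/(val _) linearP; apply: m.1.
Qed.
Fact coinv_ract_bilin : bilin (fun (a : A) (b : coinv) => a * coinv_val b).
Proof.
have m := mulr_bilin A; split=> [b|a] c x y; first exact: m.1.
by rewrite -[coinv_val _]/(val _) linearP; apply: m.2.
Qed.
Definition coinv_lmodule : lmodule coinv :=
  LModule (lact := bilin_fun coinv_lact_bilin) (@mul1r A)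
    (fun r s m => esym (mulrA (val r) (val s) m)).
Definition coinv_rmodule : rmodule coinv :=
  RModule (ract := bilin_fun coinv_ract_bilin) (@mulr1 A)
    (fun r s m => mulrA m (val r) (val s)).

Definition canonical_map : btens coinv_rmodule coinv_lmodule -> tens A H :=
  btlift (fun (a : coinv_rmodule) (a' : coinv_lmodule) => (a : A) ⊗ 1 * coact (a' : A)).

Lemma canonical_mapE (a a' : A) :
  canonical_map (btpure (a : coinv_rmodule) (a' : coinv_lmodule)) = (a ⊗ 1) * coact a'.
Proof.
have m := mulr_bilin (tens A H).
apply: (@btliftE _ _ coinv_rmodule coinv_lmodule).
  split=> [n|n] c x y; first by rewrite tpureDl tpureZl; apply: m.1.
  by rewrite linearP; apply: m.2.
move=> x r y; rewrite rmorphM /=; have /asboolP -> := valP r.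
by rewrite mulrA tensM mulr1.
Qed.

Definition quantum_principal_bundle : Prop :=
  bijective canonical_map /\ faithfully_flat coinv_lmodule.

End QuantumPrincipalBundle.
End Comodules.
Arguments coact {k H _}.

Record calculus (k : fieldType) (A : algType k) := Calculus {
  forms :> dga k;
  emb : {lrmorphism A -> forms};
  emb_inj : injective emb;
  forms_deg0 : forall w : forms, deg 0 w <-> exists a, w = emb a;
  forms_deg : forall n (w : forms), deg n w <-> w \in span [set u |
    exists (a0 : A) (a : 'I_n -> A), u = emb a0 * \prod_(i < n) dif (emb (a i))] }.
Arguments emb {k A c}.

(* D : Omega(A) -> Omega(B) ⊗ Omega(C) is a morphism of differential graded   *)
(* algebras extending delta : A -> B ⊗ C.                                     *)
Definition dga_extension (k : fieldType) (A B C : algType k) (OA : calculus A)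
    (OB : calculus B) (OC : calculus C) (delta : A -> tens B C)
    (D : {lrmorphism OA -> gtens OB OC}) : Prop :=
  dga_morphism D /\ forall a, D (emb a) = tmap emb emb (delta a).

Section FirstOrder.
Variables (k : fieldType) (H : hopf k).

Record first_order_calculus := FirstOrderCalculus {
  foc_mod :> bimodule H;
  fod : {linear H -> foc_mod};
  fod_leibniz : forall a b, fod (a * b) = bimod_ract (fod a) b + lact a (fod b);
  fod_gen : forall g : foc_mod, g \in span [set u | exists a b, u = lact a (fod b)] }.

Variable G : first_order_calculus.
Local Notation d := (@fod G).

Definition bicovariant : Prop :=
  exists (lam : {linear G -> tens H G}) (rho : {linear G -> tens G H}),
  [/\ left_coaction lam /\ right_coaction rho,
      forall g, tassoc (tmap lam idfun (rho g)) = tmap idfun rho (lam g),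
      forall (a b : H) (g : G),
        lam (bimod_ract (lact a g) b) =
        tens2 *%R bimod_ract (tens2 *%R lact (cop a) (lam g)) (cop b),
      forall (a b : H) (g : G),
        rho (bimod_ract (lact a g) b) =
        tens2 bimod_ract *%R (tens2 lact *%R (cop a) (rho g)) (cop b) &
      forall a, lam (d a) = tmap idfun d (cop a) /\
                rho (d a) = tmap d idfun (cop a)].

(* The homogeneous components of the two-sided ideal of the tensor algebra    *)
(* generated by sum_i da_i ⊗_H db_i whenever sum_i a_i db_i = 0.              *)
Inductive prolongation_ideal : forall n, tpow G n -> Prop :=
| prolongation_gen (N : nat) (a b : 'I_N -> H) :
    \sum_(i < N) lact (a i) (d (b i)) = 0 ->
    @prolongation_ideal 2
      (\sum_(i < N) tcons (d (a i)) (tcons (d (b i)) (1 : tpow G 0)))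
| prolongation_0 n : @prolongation_ideal n 0
| prolongation_lin n (c : k) (s t : tpow G n) :
    prolongation_ideal s -> prolongation_ideal t -> prolongation_ideal (c *: s + t)
| prolongation_mull m n (s : tpow G m) (t : tpow G n) :
    prolongation_ideal t -> prolongation_ideal (tpmul s t)
| prolongation_mulr m n (s : tpow G m) (t : tpow G n) :
    prolongation_ideal s -> prolongation_ideal (tpmul s t).

(* Omega is the quotient of the tensor algebra of G by the above ideal, with  *)
(* the differential extending that of G.                                      *)
Definition maximal_prolongation (Omega : calculus H) : Prop :=
  exists pi : forall n, {linear tpow G n -> Omega},
  [/\ forall h : H, pi 0%N h = emb h,
      forall m n (s : tpow G m) (t : tpow G n), pi (m + n)%N (tpmul s t) = pi m s * pi n t,
      forall h, pi 1%N (tcons (d h) (1 : tpow G 0)) = dif (emb h),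
      forall n w, deg n w <-> exists t, w = pi n t &
      forall n t, pi n t = 0 <-> prolongation_ideal t].

End FirstOrder.
Arguments fod {k H} f.

Section Horizontal.
Variables (k : fieldType) (H : hopf k) (A : comodule_algebra H).
Variables (OA : calculus A) (OH : calculus H) (D : {lrmorphism OA -> gtens OA OH}).

(* The preimage under D of Omega(A) ⊗ H, with H embedded in Omega(H) as the  *)
(* forms of degree 0. *)
Definition hor_pred : {pred OA} := fun w =>
  `[< exists t : tens OA H, D w = tmap idfun emb t >].

Fact tmap_embM (s t : tens OA H) :
  tmap idfun emb (s * t) = (tmap idfun emb s : gtens OA OH) * tmap idfun emb t.
Proof.
elim/tens_ind: s => [x h|s s' IHs IHs']; last first.
  by rewrite mulrDl !linearD /= IHs IHs' [RHS]mulrDl.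
elim/tens_ind: t => [x' h'|t t' IHt IHt']; last first.
  by rewrite mulrDr !linearD /= IHt IHt' [RHS]mulrDr.
elim/hom_ind: x' => [n x' dx'|x' y' Px' Py']; last first.
  by rewrite tpureDl mulrDr !linearD /= Px' Py' [RHS]mulrDr.
rewrite tensM !tmapE /=.
have d0 : deg 0 (emb h : OH) by apply/forms_deg0; exists h.
by rewrite [RHS](gtmulE _ _ d0 dx') mul0n scale1r rmorphM.
Qed.

Fact hor_closed : GRing.subsemialg_closed hor_pred.
Proof.
apply: GRing.subalg_closed_semi; split.
- by apply/asboolP; exists 1; rewrite rmorph1 tmapE /= rmorph1.
- move=> a u v /asboolP[s Ds] /asboolP[t Dt]; apply/asboolP; exists (a *: s + t).
  by rewrite !linearP /= Ds Dt.
- move=> u v /asboolP[s Ds] /asboolP[t Dt]; apply/asboolP; exists (s * t).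
  by rewrite rmorphM /= Ds Dt tmap_embM.
Qed.
HB.instance Definition _ := GRing.isSubalgClosed.Build k OA hor_pred hor_closed.

Record hor := Hor { hor_val : OA; _ : hor_val \in hor_pred }.
HB.instance Definition _ := [isSub for hor_val].
HB.instance Definition _ := [Choice of hor by <:].
HB.instance Definition _ := [SubChoice_isSubAlgebra of hor by <:].

Definition hor_incl : {linear hor -> OA} := val.

Lemma hor_graded n w : dga_morphism D -> w \in hor_pred -> hc n w \in hor_pred.
Proof.
move=> mD /asboolP[t Dt]; apply/asboolP; exists (tmap (hc n) idfun t).
have -> : D (hc n w) = hc n (D w).
  have dD m : deg m (D (hc m w)) by apply: (dga_morphism_deg mD); exact: hc_deg.
  rewrite [X in hc n (D X)]hc_sum linear_sum /= (hc_uniq _ _ dD).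
  by case: ltnP => // /hc_bound ->; rewrite linear0.
rewrite Dt; elim/tens_ind: t {Dt} => [x h|s t IHs IHt]; last first.
  by rewrite !linearD /= IHs IHt.
elim/hom_ind: x => [m x dx|x y Px Py]; last first.
  by rewrite tpureDl !linearD /= Px Py.
rewrite !tmapE /= (hc_id _ dx).
have d0 : deg 0 (emb h : OH) by apply/forms_deg0; exists h.
have := @hc_id _ (gtens OA OH) n _ _ (gtdeg_pure dx d0); rewrite addn0 => ->.
by case: eqP => // _; rewrite tpure0l.
Qed.
End Horizontal.

(* Main.v *)
From HB Require Import structures.
Require Import Defs.
From mathcomp Require Import all_boot ssralg.
From mathcomp Require Import boolp.

(** Write D for the extended coaction of Omega(A) and Delta for the extended
    coproduct of Omega(H).

    Both (D ⊗ id) D and (id ⊗ Delta) D are morphisms of differential graded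
    algebras out of Omega(A). They agree on A because the coaction of A is
    coassociative, and a morphism out of a calculus is determined by its values
    on A since every form is a combination of a0 da1 ... dan (calculus_ext).
    Hence D is coassociative (complete_coassoc). The same uniqueness argument
    gives (id ⊗ e) D = id, where e is the counit of H after the projection of
    Omega(H) onto its degree 0 part H (complete_counit): contracting with e is
    a morphism of differential graded algebras because e kills every form of
    positive degree.

    A form w is horizontal when D w lies in Omega(A) ⊗ H, that is, when w is in
    the kernel of the linear map L = D - (id ⊗ hc 0) D (defect0). If D w = sum
    of w_i ⊗ h_i with h_i in H, then by coassociativity the sum of
    D w_i ⊗ h_i equals the sum of w_i ⊗ Delta h_i, which lies in
    Omega(A) ⊗ H ⊗ H as Delta maps H to H ⊗ H. So L ⊗ id kills D w
    (defect_horpart). Over a field, the kernel of L ⊗ id is ker L ⊗ H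
    (tmap_ker), so D w lies in hor ⊗ H.

    Finally hor ⊗ H embeds into Omega(A) ⊗ Omega(H) (incl_emb_inj), so the
    element of hor ⊗ H that represents D w is unique. This makes the restricted
    coaction linear and multiplicative, and coassociativity and counitality are
    inherited from D. *)

Set Implicit Arguments.
Unset Strict Implicit.
Unset Printing Implicit Defensive.

Import GRing.Theory.
Local Open Scope ring_scope.

(** * Tensor products of vector spaces *)

Lemma tmapD (k : fieldType) (U U' V V' : lmodType k)
    (f : {linear U -> U'}) (g : {linear V -> V'}) (s t : tens U V) :
  tmap f g (s + t) = tmap f g s + tmap f g t.
Proof. exact: (tliftD (tmap_bilin f g)). Qed.

Lemma tassocD (k : fieldType) (U V W : lmodType k) (s t : tens (tens U V) W) :
  tassoc (s + t) = tassoc s + tassoc t.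
Proof. exact: (tliftD (tassoc_bilin2 U V W)). Qed.

Lemma tmapZ (k : fieldType) (U U' V V' : lmodType k)
    (f : {linear U -> U'}) (g : {linear V -> V'}) (a : k) (t : tens U V) :
  tmap f g (a *: t) = a *: tmap f g t.
Proof. exact: (linearZ_LR (tmap f g)). Qed.

Lemma tassocZ (k : fieldType) (U V W : lmodType k) (a : k) (t : tens (tens U V) W) :
  tassoc (a *: t) = a *: tassoc t.
Proof. exact: (linearZ_LR (@tassoc k U V W)). Qed.

Lemma difD (k : fieldType) (X : dga k) (x y : X) : dif (x + y) = dif x + dif y.
Proof. exact: linearD. Qed.

Section TensorKernels.
Variables (k : fieldType) (U V W : lmodType k).

Lemma tens_sum (t : tens U V) : exists n (u : 'I_n -> U) (v : 'I_n -> V),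
  t = \sum_i u i ⊗ v i.
Proof.
elim/tens_ind: t => [u v|s t [m [u [v ->]]] [n [u' [v' ->]]]].
  by exists 1%N, (fun=> u), (fun=> v); rewrite big_ord1.
exists (m + n)%N,
  (fun i => match split i with inl j => u j | inr j => u' j end),
  (fun i => match split i with inl j => v j | inr j => v' j end).
rewrite big_split_ord /=; congr (_ + _); apply: eq_bigr => i _.
  by rewrite (unsplitK (inl i)).
by rewrite (unsplitK (inr i)).
Qed.

Lemma tpure_sumr (u : U) n (v : 'I_n -> V) :
  u ⊗ (\sum_i v i) = \sum_i u ⊗ v i.
Proof. exact: (big_morph _ (tpureDr u) (tpure0r V u)). Qed.

(** The functional comes from the quotient by the span of the family, in which
    the class of x is nonzero. *)
Lemma functional_span n (v : 'I_n -> V) (x : V) :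
    x \notin span (fun y => exists i, v i = y) ->
  exists c : V -> k, [/\ forall a y z, c (a *: y + z) = a * c y + c z,
    c x = 1 & forall i, c (v i) = 0].
Proof.
set S := (X in span X) => xS.
have nz : lproj S x != 0.
  apply: contraNneq xS => x0; rewrite -[x]subr0; apply/lprojE.
  by rewrite x0 linear0.
have [c [lc cx]] := functional_exists nz.
exists (fun y => c (lproj S y)); split=> // [a y z|i]; first by rewrite linearP lc.
suff -> : lproj S (v i) = 0.
  by have := lc (-1) 0 0; rewrite scaler0 addr0 mulN1r addNr.
rewrite -(linear0 (lproj S)); apply/lprojE; rewrite subr0; apply: span_gen.
by exists i.
Qed.

Lemma scale_bilin (c : V -> k) :
  (forall a y z, c (a *: y + z) = a * c y + c z) ->
  bilin (fun (w : W) v => c v *: w).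
Proof.
move=> lc; split=> [v|w] a x y; first by rewrite scalerDr !scalerA mulrC.
by rewrite lc scalerDl scalerA.
Qed.

(** Tensoring with V is exact. The induction on the number of summands avoids
    choosing a basis of V: if v_0 is a combination of the other v_i it is
    absorbed into them; otherwise a functional which is 1 on v_0 and 0 on the
    other v_i shows f u_0 = 0. *)
Lemma tmap_ker (f : {linear U -> W}) (t : tens U V) : tmap f idfun t = 0 ->
  exists n (u : 'I_n -> U) (v : 'I_n -> V),
    (forall i, f (u i) = 0) /\ t = \sum_i u i ⊗ v i.
Proof.
have [n [u [v ->]]] := tens_sum t; elim: n u v => [|n IHn] u v.
  by move=> _; exists 0%N, u, v; split=> [[]|].
rewrite big_ord_recl; set v' := fun i => v (lift ord0 i).
case: (boolP (v ord0 \in span (fun y => exists i, v' i = y))).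
  case/asboolP=> m [c [s [Ss v0E]]] f0.
  have [j jE] := choice Ss.
  have v0 : v ord0 = \sum_(l < n) (\sum_(i | j i == l) c i) *: v' l.
    rewrite v0E (partition_big j predT) //=; apply: eq_bigr => l _.
    by rewrite scaler_suml; apply: eq_bigr => i /eqP <-; rewrite jE.
  have E : u ord0 ⊗ v ord0 + \sum_(i < n) u (lift ord0 i) ⊗ v (lift ord0 i) =
      \sum_(l < n) ((\sum_(i | j i == l) c i) *: u ord0 + u (lift ord0 l)) ⊗ v' l.
    rewrite v0 tpure_sumr -big_split; apply: eq_bigr => l _ /=.
    by rewrite tpureDl tpureZl tpureZr.
  by move: f0; rewrite E; exact: IHn.
case/functional_span=> c [lc c0 cv] f0.
have bc := scale_bilin lc.
have fu : f (u ord0) = 0.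
  pose g : {linear tens W V -> W} := lin_fun (tlift_linear bc).
  have gE w x : g (w ⊗ x) = c x *: w by exact: (tliftE bc).
  have := congr1 g f0; rewrite linear0 linearD /= tmapE linearD /= gE c0 scale1r.
  rewrite !linear_sum big1 ?addr0 // => i _.
  by rewrite /= tmapE gE [c _]cv scale0r.
move: f0; rewrite linearD /= tmapE fu tpure0l add0r.
case/IHn=> m [u' [w [fu' ->]]].
exists m.+1, (fun i => if unlift ord0 i is Some l then u' l else u ord0),
  (fun i => if unlift ord0 i is Some l then w l else v ord0).
split=> [i|]; first by case: unliftP => [l _|_].
rewrite big_ord_recl unlift_none; congr (_ + _).
by apply: eq_bigr => i _; rewrite liftK.
Qed.

Lemma tmap_inj (f : {linear U -> W}) :
  injective f -> injective (tmap f (@idfun V)).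
Proof.
move=> injf s t st; apply/eqP; rewrite -subr_eq0; apply/eqP.
have : tmap f idfun (s - t) = 0 by rewrite linearB /= st subrr.
case/tmap_ker=> n [u [v [fu ->]]]; apply: big1 => i _.
by have -> : u i = 0; [apply: injf; rewrite linear0 | rewrite tpure0l].
Qed.

End TensorKernels.

Section TensorInjections.
Variable k : fieldType.

Lemma tpureBl (U V : lmodType k) (u u' : U) (v : V) :
  (u - u') ⊗ v = u ⊗ v - u' ⊗ v.
Proof. by rewrite tpureDl -[- u']scaleN1r tpureZl scaleN1r. Qed.

Lemma tmap_cancel (U U' V V' : lmodType k) (f : {linear U -> U'}) (f' : {linear U' -> U})
    (g : {linear V -> V'}) (g' : {linear V' -> V}) :
  cancel f f' -> cancel g g' -> cancel (tmap f g) (tmap f' g').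
Proof.
move=> fK gK; elim/tens_ind=> [u v|s t IHs IHt]; first by rewrite !tmapE fK gK.
by rewrite !tmapD IHs IHt.
Qed.

Variables U V W : lmodType k.

Definition tunassoc : tens U (tens V W) -> tens (tens U V) W :=
  tlift (fun u s => tmap (lin_fun ((tpure_bilin U V).2 u)) idfun s).

Lemma tassocK : cancel (@tassoc k U V W) tunassoc.
Proof.
have b : bilin (fun u (s : tens V W) => tmap (lin_fun ((tpure_bilin U V).2 u)) idfun s).
  split=> [s|u] a x y; last exact: linearP.
  elim/tens_ind: s => [v w|s t IHs IHt].
    by rewrite !tmapE /= /lin_fun !(tpureDl, tpureZl).
  by rewrite !tmapD IHs IHt scalerDr addrACA.
elim/tens_ind=> [s w|s t IHs IHt]; last first.
  by rewrite tassocD [LHS](tliftD b) [LHS](congr2 _ IHs IHt).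
elim/tens_ind: s => [u v|s t IHs IHt].
  by rewrite tassocE /tunassoc (tliftE b) tmapE.
by rewrite tpureDl tassocD [LHS](tliftD b) [LHS](congr2 _ IHs IHt).
Qed.

End TensorInjections.

(** * Morphisms of differential graded algebras *)

Section GradedMaps.
Variable k : fieldType.

Section Map.
Variables (X X' Y Y' : dga k) (f : {lrmorphism X -> X'}) (g : {lrmorphism Y -> Y'}).
Hypotheses (mf : dga_morphism f) (mg : dga_morphism g).

(** Preservation of degrees is what makes the Koszul signs on both sides
    agree. *)
Lemma gtmapM (s t : gtens X Y) :
  tmap f g (s * t) = (tmap f g s : gtens X' Y') * tmap f g t.
Proof.
elim/gtens_ind: s => [i j x y dx dy|s s' IHs IHs']; last first.
  by rewrite mulrDl !tmapD IHs IHs' [RHS]mulrDl.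
elim/gtens_ind: t => [i' j' x' y' dx' dy'|t t' IHt IHt']; last first.
  by rewrite mulrDr !tmapD IHt IHt' [RHS]mulrDr.
rewrite [_ * _](gtmulE _ _ dy dx') tmapZ !tmapE /=.
rewrite [RHS](gtmulE _ _ (dga_morphism_deg mg dy) (dga_morphism_deg mf dx')).
by rewrite !rmorphM.
Qed.

Lemma gtmap_dif (t : gtens X Y) :
  tmap f g (dif t) = dif (tmap f g t : gtens X' Y').
Proof.
elim/gtens_ind: t => [i j x y dx dy|s t IHs IHt]; last first.
  by rewrite difD !tmapD IHs IHt [RHS]difD.
rewrite /= (gtdifE _ dx) tmapD tmapZ !tmapE /=.
rewrite (gtdifE _ (dga_morphism_deg mf dx)).
by rewrite (dga_morphism_dif mf) (dga_morphism_dif mg).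
Qed.

End Map.

Lemma deg_tpure (X Y : dga k) i j (x : X) (y : Y) :
  deg i x -> deg j y -> deg (i + j) (x ⊗ y : gtens X Y).
Proof. exact: gtdeg_pure. Qed.

Section Assoc.
Variables X Y Z : dga k.

Lemma gt3_ind (P : gtens (gtens X Y) Z -> Prop) :
    (forall i j l x y z, deg i x -> deg j y -> deg l z ->
       P (x ⊗ y ⊗ z)) ->
    (forall s t, P s -> P t -> P (s + t)) -> forall t, P t.
Proof.
move=> Ph PD; elim/gtens_ind=> // i l t z _ dz.
elim/gtens_ind: t => [a b x y dx dy|s t Ps Pt]; first exact: Ph dx dy dz.
by rewrite tpureDl; apply: PD.
Qed.

(** For x ⊗ y ⊗ z times x' ⊗ y' ⊗ z', both bracketings move x' past y and z,
    and y' past z, so they give the same sign. *)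
Lemma gtassocM (s t : gtens (gtens X Y) Z) :
  tassoc (s * t) = (tassoc s : gtens X (gtens Y Z)) * tassoc t.
Proof.
elim/gt3_ind: s => [i j l x y z dx dy dz|s s' IHs IHs']; last first.
  by rewrite mulrDl !tassocD IHs IHs' [RHS]mulrDl.
elim/gt3_ind: t => [i' j' l' x' y' z' dx' dy' dz'|t t' IHt IHt']; last first.
  by rewrite mulrDr !tassocD IHt IHt' [RHS]mulrDr.
rewrite [_ * _](gtmulE _ _ dz (deg_tpure dx' dy')) tassocZ !tassocE.
rewrite [RHS](gtmulE _ _ (deg_tpure dy dz) dx').
rewrite [X in tassoc (X ⊗ _)](gtmulE _ _ dy dx') [X in _ = _ *: (_ ⊗ X)](gtmulE _ _ dz dy').
rewrite tpureZl tassocZ tassocE tpureZr !scalerA -!exprD.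
by congr (_ ^+ _ *: _); rewrite mulnDr mulnDl addnAC [(j * _ + _)%N]addnC.
Qed.

Lemma gtassoc_dif (t : gtens (gtens X Y) Z) :
  tassoc (dif t) = dif (tassoc t : gtens X (gtens Y Z)).
Proof.
elim/gt3_ind: t => [i j l x y z dx dy dz|s t IHs IHt]; last first.
  by rewrite difD !tassocD IHs IHt [RHS]difD.
rewrite /= (gtdifE _ (deg_tpure dx dy)) /= (gtdifE _ dx) tpureDl tpureZl.
rewrite !tassocD !tassocZ !tassocE (gtdifE _ dx) /= (gtdifE _ dy).
by rewrite tpureDr tpureZr scalerDr scalerA exprD addrA.
Qed.

End Assoc.

(** A calculus is generated by the algebra and its differentials, so a
    morphism out of it is determined on the algebra. *)
Lemma calculus_ext (A : algType k) (OA : calculus A) (Y : dga k) (f g : OA -> Y) :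
    linear f -> linear g ->
    {morph f : x y / x * y} -> {morph g : x y / x * y} ->
    (forall x, f (dif x) = dif (f x)) -> (forall x, g (dif x) = dif (g x)) ->
    (forall a, f (emb a) = g (emb a)) -> f =1 g.
Proof.
move=> lf lg fM gM fd gd fg.
have fgE n (a : 'I_n -> A) (a0 : A) :
    f (emb a0 * \prod_(i < n) dif (emb (a i))) =
    g (emb a0 * \prod_(i < n) dif (emb (a i))).
  elim: n a => [|n IHn] a; first by rewrite big_ord0 mulr1.
  by rewrite big_ord_recr mulrA fM gM IHn fd gd fg.
move=> x; elim/hom_ind: x => [n x|x y fx fy]; last first.
  by rewrite -[x]scale1r lf lg fx fy.
move/forms_deg; apply: (span_ind (P := fun y => f y = g y)) => [|c _ v [a0 [a ->]] IHv].
  by rewrite -(rmorph0 (@emb _ _ OA)) fg.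
by rewrite lf lg fgE IHv.
Qed.

End GradedMaps.

(** * The degree 0 part of a calculus *)

Section Deg0.
Variables (k : fieldType) (A : algType k) (OA : calculus A).

Fact deg0part_ex (w : OA) : exists a : A, hc 0 w = emb a.
Proof. by apply/forms_deg0; exact: hc_deg. Qed.

(** The projection of a calculus onto its forms of degree 0, read in A
    through the isomorphism emb. *)
Definition deg0part (w : OA) : A := projT1 (cid (deg0part_ex w)).

Lemma emb_deg0part w : emb (deg0part w) = hc 0 w.
Proof. by rewrite /deg0part; case: cid. Qed.

Fact deg0part_linear : linear deg0part.
Proof.
by move=> a x y; apply: (@emb_inj _ _ OA); rewrite linearP /= !emb_deg0part linearP.
Qed.
HB.instance Definition _ :=
  GRing.isLinear.Build k OA A _ deg0part deg0part_linear.

Lemma deg_emb a : deg 0 (emb a : OA).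
Proof. by apply/forms_deg0; exists a. Qed.

Lemma embK : cancel (@emb _ _ OA) deg0part.
Proof.
by move=> a; apply: (@emb_inj _ _ OA); rewrite emb_deg0part (hc_id _ (deg_emb a)).
Qed.

Lemma deg0part_pos n (w : OA) : deg n.+1 w -> deg0part w = 0.
Proof.
move=> dw; apply: (@emb_inj _ _ OA).
by rewrite emb_deg0part (hc_id _ dw) rmorph0.
Qed.

Lemma deg0partM : {morph deg0part : x y / x * y}.
Proof.
move=> x y.
elim/hom_ind: x => [[|n] x dx|x x' IH IH']; last by rewrite mulrDl !linearD /= IH IH' mulrDl.
  elim/hom_ind: y => [[|m] y dy|y y' IH IH']; last by rewrite mulrDr !linearD /= IH IH' mulrDr.
    move/forms_deg0: dx => [a ->]; move/forms_deg0: dy => [b ->].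
    by rewrite -rmorphM !embK.
  by rewrite (deg0part_pos dy) mulr0 (deg0part_pos (deg_mul dx dy)).
elim/hom_ind: y => [m y dy|y y' IH IH']; last by rewrite mulrDr !linearD /= IH IH' mulrDr.
by rewrite (deg0part_pos dx) mul0r; apply: (@deg0part_pos (n + m)); exact: deg_mul dx dy.
Qed.

Lemma deg0part_dif w : deg0part (dif w) = 0.
Proof.
elim/hom_ind: w => [n w dw|x y IHx IHy]; first exact: deg0part_pos (dif_deg dw).
by rewrite !linearD /= IHx IHy addr0.
Qed.

End Deg0.

(** * Contraction with a character of the degree 0 part *)

Section Contraction.
Variables (k : fieldType) (X : dga k) (B : algType k) (OB : calculus B).
Variable c : {lrmorphism B -> k^o}.

(** The map id ⊗ (c o deg0part). *)
Definition contract (t : tens X OB) : X :=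
  tlift (fun x y => (c (deg0part y) : k) *: x) t.

Fact contract_bilin : bilin (fun (x : X) (y : OB) => (c (deg0part y) : k) *: x).
Proof. by apply: scale_bilin => a y z; rewrite !linearP. Qed.

Lemma contractE x y : contract (x ⊗ y) = (c (deg0part y) : k) *: x.
Proof. exact: (tliftE contract_bilin). Qed.

HB.instance Definition _ :=
  GRing.isLinear.Build k (tens X OB) X _ contract (tlift_linear contract_bilin).

(** The graded tensor product has signs, but they only occur where the right
    factor y of the first tensor has positive degree, and then both sides
    vanish. *)
Lemma contractM (s t : gtens X OB) : contract (s * t) = contract s * contract t.
Proof.
elim/gtens_ind: s => [i j x y dx dy|s s' IHs IHs']; last first.
  by rewrite mulrDl !linearD /= IHs IHs' [RHS]mulrDl.
elim/gtens_ind: t => [i' j' x' y' dx' dy'|t t' IHt IHt']; last first.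
  by rewrite mulrDr !linearD /= IHt IHt' [RHS]mulrDr.
rewrite [_ * _](gtmulE _ _ dy dx') linearZ /= !contractE deg0partM.
case: j dy => [_|j dy]; last first.
  by rewrite (deg0part_pos dy) mul0r linear0 !scale0r scaler0 mul0r.
by rewrite mul0n scale1r rmorphM /= -scalerAl -scalerAr scalerA.
Qed.

(** The summand x ⊗ dif y of the differential is contracted to 0, since
    dif y has no part of degree 0. *)
Lemma contract_dif (t : gtens X OB) : contract (dif t) = dif (contract t).
Proof.
elim/gtens_ind: t => [i j x y dx dy|s t IHs IHt]; last first.
  by rewrite !linearD /= IHs IHt.
rewrite /= (gtdifE _ dx) linearD linearZ /= !contractE deg0part_dif.
by rewrite linear0 scale0r scaler0 addr0 linearZ.
Qed.

End Contraction.

(** * Coassociativity and counitality of the extended coaction *)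

Section CompleteCalculus.
Variables (k : fieldType) (H : hopf k) (OH : calculus H).
Variables (A : comodule_algebra H) (OA : calculus A).
Variable D : {lrmorphism OA -> gtens OA OH}.
Hypothesis eD : dga_extension coact D.

(** Both sides are morphisms of differential graded algebras, which agree on
    A by the coassociativity of the coaction of A. *)
Lemma complete_coassoc (Delta : {lrmorphism OH -> gtens OH OH}) :
  dga_extension cop Delta ->
  forall w, tassoc (tmap D idfun (D w)) = tmap idfun Delta (D w).
Proof.
move=> eDelta; case: (eD) (eDelta) => mD Demb [mDelta Deltaemb].
have mid (X : dga k) : dga_morphism (@idfun X) by [].
have [coassoc _] := coact_coaction A.
apply: (@calculus_ext _ _ _ (gtens OA (gtens OH OH))
  (fun w => tassoc (tmap D idfun (D w))) (fun w => tmap idfun Delta (D w))).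
- by move=> a x y; rewrite (linearP D) !tmapD !tmapZ tassocD tassocZ.
- by move=> a x y; rewrite (linearP D) tmapD tmapZ.
- move=> x y; rewrite rmorphM (gtmapM mD (mid OH)); exact: gtassocM.
- move=> x y; rewrite rmorphM; exact: (gtmapM (mid OA) mDelta).
- move=> x; rewrite (dga_morphism_dif mD) (gtmap_dif mD (mid OH)).
  exact: gtassoc_dif.
- move=> x; rewrite (dga_morphism_dif mD); exact: (gtmap_dif (mid OA) mDelta).
move=> a; rewrite Demb.
have E1 (t : tens A H) : tassoc (tmap D idfun (tmap emb emb t)) =
    tmap emb (tmap emb emb) (tassoc (tmap coact idfun t)) :> tens OA (tens OH OH).
  elim/tens_ind: t => [x h|s t IHs IHt]; last by rewrite !(tmapD, tassocD) IHs IHt.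
  rewrite !tmapE /= Demb.
  move: (coact x : tens A H) => u; elim/tens_ind: u => [y g|s t IHs IHt].
    by rewrite tmapE !tassocE !tmapE /= tmapE.
  by rewrite tmapD !tpureDl !(tmapD, tassocD) IHs IHt.
have E2 (t : tens A H) : tmap idfun Delta (tmap emb emb t) =
    tmap emb (tmap emb emb) (tmap idfun cop t) :> tens OA (tens OH OH).
  elim/tens_ind: t => [x h|s t IHs IHt]; last by rewrite !(tmapD, tassocD) IHs IHt.
  by rewrite !tmapE /= Deltaemb.
by rewrite [RHS]E2 [LHS]E1 coassoc.
Qed.

(** Contraction with the counit makes the left-hand side a morphism of
    differential graded algebras, equal to the identity on A. *)
Lemma complete_counit w : contract cou (D w) = w.
Proof.
case: (eD) => mD Demb; have [_ counit] := coact_coaction A.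
apply: (@calculus_ext _ _ _ OA (fun w => contract cou (D w)) id).
- by move=> a x y; rewrite linearP /= linearP.
- by [].
- by move=> x y; rewrite rmorphM contractM.
- by [].
- by move=> x; rewrite (dga_morphism_dif mD) contract_dif.
- by [].
have bc : bilin (fun (u : A) (h : H) => (cou h : k) *: u).
  by apply: scale_bilin => b y z; rewrite linearP.
pose g : {linear tens A H -> A} := lin_fun (tlift_linear bc).
have gE x h : g (x ⊗ h) = (cou h : k) *: x by exact: (tliftE bc).
have E (t : tens A H) : contract cou (tmap emb emb t : tens OA OH) = emb (g t).
  elim/tens_ind: t => [x h|s t IHs IHt]; last by rewrite tmapD !linearD /= IHs IHt.
  by rewrite tmapE contractE embK gE linearZ.
by move=> a; rewrite Demb -[in RHS](counit a); exact: E.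
Qed.

End CompleteCalculus.

(** * The coaction on horizontal forms *)

Section HorizontalCoaction.
Variables (k : fieldType) (H : hopf k) (OH : calculus H).
Variable Delta : {lrmorphism OH -> gtens OH OH}.
Hypothesis eDelta : dga_extension cop Delta.
Variables (A : comodule_algebra H) (OA : calculus A).
Variable D : {lrmorphism OA -> gtens OA OH}.
Hypothesis eD : dga_extension coact D.

Local Notation incl := (hor_incl D).

(** The component of D w in Omega(A) ⊗ H. *)
Definition horpart (w : OA) : tens OA H := tmap idfun (@deg0part _ _ OH) (D w).

Fact defect_linear : linear (fun w => (D w : tens OA OH) - tmap idfun emb (horpart w)).
Proof.
move=> a x y; rewrite /horpart (linearP D) !tmapD !tmapZ.
by rewrite scalerBr opprD addrACA.
Qed.

(** The component of D w in Omega(A) ⊗ Omega(H)_{>0}, which measures how far w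
    is from being horizontal. *)
Definition defect : {linear OA -> tens OA OH} := lin_fun defect_linear.

Lemma horP w : w \in hor_pred D <-> D w = tmap idfun emb (horpart w).
Proof.
split=> [/asboolP[t Dt]|Dw]; last by apply/asboolP; exists (horpart w).
by rewrite /horpart Dt; congr (tmap _ _ _); rewrite (tmap_cancel (f' := idfun) _ (@embK _ _ OH)).
Qed.

Lemma defect0 w : defect w = 0 <-> w \in hor_pred D.
Proof.
rewrite horP; split=> [/eqP|Dw]; first by rewrite subr_eq0 => /eqP.
by apply/eqP; rewrite subr_eq0; apply/eqP.
Qed.

Lemma emb_horpart w : tmap idfun emb (horpart w) = tmap idfun (hc 0) (D w).
Proof.
rewrite /horpart; move: (D w : tens OA OH) => t.
elim/tens_ind: t => [x y|s t IHs IHt]; first by rewrite !tmapE /= emb_deg0part.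
by rewrite !tmapD IHs IHt.
Qed.

(** By coassociativity, (D ⊗ id) D w = (id ⊗ Delta) D w; since D w lies in
    Omega(A) ⊗ H and Delta extends the coproduct of H, the middle tensor factor
    of this element has degree 0, so the defect of the first legs vanishes. *)
Lemma defect_horpart w : w \in hor_pred D -> tmap defect idfun (horpart w) = 0.
Proof.
move=> /horP Dw.
have idK (V : lmodType k) : cancel (@idfun V) idfun by [].
apply: (can_inj (tmap_cancel (idK (tens OA OH)) (@embK _ _ OH))).
apply: (can_inj (@tassocK _ _ _ _)).
rewrite ![in RHS](linear0 (tmap _ _)) [RHS](linear0 (@tassoc _ _ _ _)).
(* defect ⊗ id, expressed by D ⊗ id and the projection of the middle factor
   onto degree 0. *)
have E1 (t : tens OA H) : tassoc (tmap idfun emb (tmap defect idfun t)) =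
    tassoc (tmap D idfun (tmap idfun emb t)) -
    tmap idfun (tmap (hc 0) idfun) (tassoc (tmap D idfun (tmap idfun emb t)))
    :> tens OA (tens OH OH).
  elim/tens_ind: t => [x h|s t IHs IHt]; last first.
    by rewrite !(tmapD, tassocD) IHs IHt opprD addrACA.
  rewrite !tmapE /= /lin_fun emb_horpart tpureBl linearB /=; congr (_ - _).
  move: (D x : tens OA OH) => u; elim/tens_ind: u => [y g|s t IHs IHt].
    by rewrite tmapE !tassocE !tmapE /= tmapE.
  by rewrite tmapD !tpureDl !(tmapD, tassocD) /= IHs IHt.
rewrite E1 -Dw (complete_coassoc eD eDelta) Dw.
(* The middle factor of (id ⊗ Delta) t is in H already. *)
have E2 (t : tens OA H) : tmap idfun Delta (tmap idfun emb t) =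
  tmap idfun (tmap (hc 0) idfun) (tmap idfun Delta (tmap idfun emb t)) :> tens OA (tens OH OH).
  elim/tens_ind: t => [x h|s t IHs IHt]; last by rewrite !(tmapD, tassocD) /= -IHs -IHt.
  rewrite !tmapE /=; congr (_ ⊗ _); rewrite eDelta.2.
  move: (cop h : tens H H) => u; elim/tens_ind: u => [y g|s t IHs IHt].
    by rewrite !tmapE /= (hc_id _ (deg_emb _ y)).
  by rewrite !(tmapD, tassocD) /= -IHs -IHt.
by rewrite -[X in _ - X = _]E2 subrr.
Qed.

(** The kernel of defect ⊗ id is hor ⊗ H. *)
Lemma horpart_hor w : w \in hor_pred D ->
  exists t : tens (hor D) H, tmap incl idfun t = horpart w.
Proof.
move=> /defect_horpart/tmap_ker[n [u [v [u0 ->]]]].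
have uh i : u i \in hor_pred D by apply/defect0.
exists (\sum_i (Hor (uh i) : hor D) ⊗ v i).
by rewrite linear_sum; apply: eq_bigr => i _; rewrite /= tmapE.
Qed.

Lemma incl_embE (t : tens (hor D) H) :
  tmap incl (@emb _ _ OH) t = tmap idfun emb (tmap incl idfun t).
Proof.
elim/tens_ind: t => [x h|s t IHs IHt]; first by rewrite !tmapE.
by rewrite !tmapD IHs IHt.
Qed.

Fact coact_hor_ex (w : hor D) :
  exists t : tens (hor D) H, tmap incl emb t = D (incl w).
Proof.
have [t tE] := horpart_hor (valP w); exists t.
rewrite incl_embE tE; exact/esym/(horP _).1/(valP w).
Qed.

(** Split into incl ⊗ id, injective because incl is, and id ⊗ emb, which has
    the left inverse id ⊗ deg0part. *)
Lemma incl_emb_inj : injective (tmap incl (@emb _ _ OH)).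
Proof.
move=> s t st; apply: (@tmap_inj _ _ _ _ incl); first exact: val_inj.
have idK : cancel (@idfun OA) idfun by [].
apply: (can_inj (tmap_cancel idK (@embK _ _ OH))).
by rewrite -!incl_embE.
Qed.

(** No sign occurs in the graded product, as the right factors have degree 0;
    see tmap_embM. *)
Lemma incl_embM (s t : tens (hor D) H) : tmap incl emb (s * t) =
  (tmap incl emb s : gtens OA OH) * tmap incl emb t.
Proof.
rewrite !incl_embE -tmap_embM; congr (tmap _ _ _).
elim/tens_ind: s => [x h|s s' IHs IHs']; last first.
  by rewrite mulrDl !tmapD IHs IHs' mulrDl.
elim/tens_ind: t => [y g|t t' IHs IHs']; last first.
  by rewrite mulrDr !tmapD IHs IHs' mulrDr.
by rewrite tensM !tmapE tensM.
Qed.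

(** The axioms hold after the embedding into forms, where they are the
    coassociativity and counitality of D. *)
Lemma hor_right_coaction (delta : {linear hor D -> tens (hor D) H}) :
  (forall w, tmap incl emb (delta w) = D (incl w)) -> right_coaction delta.
Proof.
move=> deltaE; split=> v.
  apply: (@tmap_inj _ _ _ _ incl); first exact: val_inj.
  have idK : cancel (@idfun OA) idfun by [].
  apply: (can_inj (tmap_cancel idK (tmap_cancel (@embK _ _ OH) (@embK _ _ OH)))).
  have E1 (t : tens (hor D) H) :
      tmap idfun (tmap emb emb) (tmap incl idfun (tassoc (tmap delta idfun t))) =
      tassoc (tmap D idfun (tmap incl emb t)) :> tens OA (tens OH OH).
    elim/tens_ind: t => [x h|s t IHs IHt]; last by rewrite !(tmapD, tassocD) /= IHs IHt.
    rewrite !tmapE /= -deltaE.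
    move: (delta x) => u; elim/tens_ind: u => [y g|s t IHs IHt].
      by rewrite tmapE !tassocE !tmapE /= tmapE.
    by rewrite tmapD !tpureDl !(tmapD, tassocD) /= IHs IHt.
  have E2 (t : tens (hor D) H) :
      tmap idfun (tmap emb emb) (tmap incl idfun (tmap idfun cop t)) =
      tmap idfun Delta (tmap incl emb t) :> tens OA (tens OH OH).
    elim/tens_ind: t => [x h|s t IHs IHt]; last by rewrite !(tmapD, tassocD) /= IHs IHt.
    by rewrite !tmapE /= eDelta.2.
  by rewrite [LHS]E1 [RHS]E2 !deltaE (complete_coassoc eD eDelta).
apply: val_inj; rewrite -[RHS](complete_counit eD).
have bc : bilin (fun (u : hor D) (h : H) => (cou h : k) *: u).
  by apply: scale_bilin => b y z; rewrite linearP.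
pose g : {linear tens (hor D) H -> hor D} := lin_fun (tlift_linear bc).
have gE x h : g (x ⊗ h) = (cou h : k) *: x by exact: (tliftE bc).
have E (t : tens (hor D) H) : incl (g t) = contract cou (tmap incl emb t : tens OA OH).
  elim/tens_ind: t => [x h|s t IHs IHt]; last first.
    by rewrite tmapD (linearD g) (linearD incl) IHs IHt [RHS]linearD.
  by rewrite tmapE contractE embK gE linearZ.
by rewrite -[RHS]/(contract cou (D (incl v))) -deltaE -E.
Qed.

Definition coact_hor (w : hor D) : tens (hor D) H := projT1 (cid (coact_hor_ex w)).

Lemma coact_horE w : tmap incl emb (coact_hor w) = D (incl w).
Proof. by rewrite /coact_hor; case: cid. Qed.

Fact coact_hor_linear : linear coact_hor.
Proof.
move=> a x y; apply: incl_emb_inj.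
by rewrite linearP /= !coact_horE !linearP.
Qed.
HB.instance Definition _ :=
  GRing.isLinear.Build k (hor D) (tens (hor D) H) _ coact_hor coact_hor_linear.

Fact coact_hor_monoid : monoid_morphism coact_hor.
Proof.
split; first by apply: incl_emb_inj; rewrite coact_horE tmapE !rmorph1.
move=> x y; apply: incl_emb_inj.
by rewrite coact_horE incl_embM !coact_horE -rmorphM.
Qed.
HB.instance Definition _ :=
  GRing.isMonoidMorphism.Build (hor D) (tens (hor D) H) coact_hor coact_hor_monoid.

Definition coact_hor_lrmorphism : {lrmorphism hor D -> tens (hor D) H} := coact_hor.

End HorizontalCoaction.

Theorem lemma4p2p14 (k : fieldType) (H : hopf k)
  (G : first_order_calculus H) (OH : calculus H)
  (hG : bicovariant G) (hOH : maximal_prolongation G OH)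
  (hDelta : exists Delta : {lrmorphism OH -> gtens OH OH}, dga_extension cop Delta)
  (A : comodule_algebra H) (hA : quantum_principal_bundle A)
  (OA : calculus A) (DeltaA : {lrmorphism OA -> gtens OA OH})
  (hDeltaA : dga_extension coact DeltaA) :
  (forall w : OA, w \in hor_pred DeltaA ->
     exists t : tens (hor DeltaA) H, DeltaA w = tmap (hor_incl DeltaA) emb t) /\
  (exists delta : {lrmorphism hor DeltaA -> tens (hor DeltaA) H},
     right_coaction delta /\
     forall w : hor DeltaA,
       tmap (hor_incl DeltaA) emb (delta w) = DeltaA (hor_incl DeltaA w)).
Proof.
have [Delta eDelta] := hDelta; split.
  move=> w hw; have [t tE] := coact_hor_ex eDelta hDeltaA (Hor hw).
  by exists t; rewrite tE.
exists (coact_hor_lrmorphism eDelta hDeltaA); split.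
  by apply: (hor_right_coaction eDelta hDeltaA); exact: coact_horE.
exact: coact_horE.
Qed.
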